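(* For every $K\geq 1$ there is a constant $\delta\in (0,1)$ depending only on $K$ such that every quadrilateral $Q$ with modulus $M(Q)\in [1/K, K]$ contains a disk of radius $\delta \max \{ s_a(Q), s_b(Q) \}$.
   Context: A quadrilateral $Q=Q(v_1,v_2,v_3,v_4)$ is a bounded Jordan domain in $\mathbb{C}$ (an open connected set whose boundary is a homeomorphic image of the circle) together with four distinct boundary points $v_1,v_2,v_3,v_4$ (its vertices), labeled in counter-clockwise order. Modulus: there is a conformal map $\phi$ of $Q$ onto the interior of a rectangle with vertices $0, M, M+i, i$ for some $M>0$, whose homeomorphic extension to the closures satisfies $(\phi(v_1),\phi(v_2),\phi(v_3),\phi(v_4))=(0,M,M+i,i)$; the number $M>0$ is uniquely determined and is called the modulus $M(Q)$. Sides: the $a$-sides of $Q$ are the two closed sub-arcs of $\partial Q$ from $v_1$ to $v_2$ and from $v_3$ to $v_4$ containing no vertices in their interior; the $b$-sides are likewise the sub-arcs from $v_2$ to $v_3$ and from $v_4$ to $v_1$. Internal distances: $s_a(Q)$ is the infimum of the lengths $\ell(C)$ over Jordan arcs $C$ lying in $Q$ (except for their end points, which are on $\partial Q$) with end points on different $a$-sides; $s_b(Q)$ is the infimum of $\ell(C)$ over Jordan arcs $C$ lying in $Q$ (except for their end points) with end points on different $b$-sides. *)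

(* Defs.v *)
From HB Require Import structures.
From mathcomp Require Import all_boot all_order all_algebra.
From mathcomp Require Import all_classical all_reals all_analysis.
From mathcomp Require Import complex.

Set Implicit Arguments.
Unset Strict Implicit.
Unset Printing Implicit Defensive.

Import Order.TTheory GRing.Theory Num.Theory.
Import numFieldNormedType.Exports.
Import ComplexField.Normc.

Local Open Scope classical_set_scope.
Local Open Scope ring_scope.
Local Open Scope complex_scope.

(* The complex numbers as a [numFieldType], so that they carry the topology and
   the normed module structure over themselves given by the complex modulus. *)
Definition plane (R : realType) : numFieldType := R[i].

Definition homeomorphism_on (T U : topologicalType) (A : set T) (B : set U)
    (f : T -> U) : Prop :=
  [/\ f @` A = B,
      {within A, continuous f} &
      exists g : U -> T,
        {within B, continuous g} /\ (forall x, A x -> g (f x) = x)].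

Section Plane.
Variable R : realType.
Local Notation C := (plane R).
Local Notation I01 := (`[(0 : R), (1 : R)]%classic : set R).
Implicit Types (D A B : set C) (z u v : C).

Definition boundary D : set C := closure D `\` D°.

Definition cis (t : R) : C := cos t +i* sin t.

Definition unit_circle : set C := [set z : C | normc z = 1].

(* Scalars of the normed module [C] are complex, so the difference quotients in
   [derivable phi z 1] are taken over complex increments. *)
Definition holomorphic_on D (phi : C -> C) : Prop :=
  forall z, D z -> derivable phi z 1.

(* The closed curve [t |-> gamma (cis t)], 0 <= t <= 2 pi, has winding number
   [n] around [z]: [theta] is a continuous branch of the argument of
   [gamma (cis t) - z]. *)
Definition has_winding_number (gamma : C -> C) z (n : int) : Prop :=
  exists theta : R -> R,
    [/\ {within `[0, 2 * pi], continuous theta},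
        (forall t, 0 <= t <= 2 * pi ->
           gamma (cis t) - z
           = (normc (gamma (cis t) - z))%:C * cis (theta t)),
        (forall t, 0 <= t <= 2 * pi -> gamma (cis t) != z) &
        theta (2 * pi) - theta 0 = 2 * pi * n%:~R].

(* [gamma] traverses the boundary with winding number 1 around the points of the
   domain, i.e. counter-clockwise, and meets v1, v2, v3, v4 in this order. *)
Record quadrilateral := Quadrilateral {
  dom : set C;
  v1 : C;
  v2 : C;
  v3 : C;
  v4 : C;
  dom_open : open dom;
  dom_connected : connected dom;
  dom_bounded : bounded_set dom;
  dom_jordan : exists gamma : C -> C,
    [/\ homeomorphism_on unit_circle (boundary dom) gamma,
        (forall z, dom z -> has_winding_number gamma z 1) &
        exists t1 t2 t3 t4 : R,
          [/\ t1 < t2, t2 < t3, t3 < t4 & t4 < t1 + 2 * pi] /\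
          [/\ v1 = gamma (cis t1), v2 = gamma (cis t2),
              v3 = gamma (cis t3) & v4 = gamma (cis t4)]]
}.

Definition rectangle (M : R) : set C :=
  [set z : C | 0 < complex.Re z < M /\ 0 < complex.Im z < 1].

(* [phi] is the conformal map together with its extension to the closures. *)
Definition is_modulus (Q : quadrilateral) (M : R) : Prop :=
  0 < M /\
  exists phi : C -> C,
    [/\ holomorphic_on (dom Q) phi,
        phi @` dom Q = rectangle M,
        homeomorphism_on (closure (dom Q)) (closure (rectangle M)) phi &
        [/\ phi (v1 Q) = 0, phi (v2 Q) = M%:C,
            phi (v3 Q) = M +i* 1 & phi (v4 Q) = 0 +i* 1]].

Definition arc_between A u v : Prop :=
  exists gamma : R -> C,
    [/\ homeomorphism_on I01 A gamma, gamma 0 = u & gamma 1 = v].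

(* For consecutive vertices [u] and [v] exactly one of the two boundary arcs from
   [u] to [v] qualifies as [A]. *)
Definition side (Q : quadrilateral) u v : set C :=
  [set z : C | exists A,
    [/\ arc_between A u v, A `<=` boundary (dom Q),
        (forall w, w \in [:: v1 Q; v2 Q; v3 Q; v4 Q] -> A w ->
           w = u \/ w = v) &
        A z]].

(* For an injective [gamma] this depends only on the image of [0, 1]. *)
Definition arc_length (gamma : R -> C) : \bar R :=
  ereal_sup [set (\sum_(x <- zip s (0 :: s))
                    normc (gamma x.1 - gamma x.2))%:E
            | s in itv_partition 0 1].

(* Both orientations of an arc are admissible parametrizations, so it is enough
   to consider those starting on [A] and ending on [B]. *)
Definition crosscut D A B (gamma : R -> C) : Prop :=
  [/\ homeomorphism_on I01 (gamma @` I01) gamma,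
      (forall t, 0 < t < 1 -> D (gamma t)),
      A (gamma 0) & B (gamma 1)].

Definition distance_within D A B : \bar R :=
  ereal_inf [set arc_length gamma | gamma in crosscut D A B].

Definition s_a (Q : quadrilateral) : \bar R :=
  distance_within (dom Q) (side Q (v1 Q) (v2 Q)) (side Q (v3 Q) (v4 Q)).

Definition s_b (Q : quadrilateral) : \bar R :=
  distance_within (dom Q) (side Q (v2 Q) (v3 Q)) (side Q (v4 Q) (v1 Q)).

End Plane.

(* Main.v *)
(* Let f be the inverse of the conformal map, w0 the image under f of the centre
   of the rectangle, and D comparable to the distance from w0 to the boundary of
   Q.  The metric |dw| / max(D, |w - w0|), cut off at |w - w0| = 2^n D, gives Q
   an area O(n), so by the length-area method every vertical or horizontal strip
   of the rectangle contains a line whose image has length O(sqrt n).  Four such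
   lines enclose the centre; a segment from w0 to a nearby point outside Q must
   cross them, so one of the four images comes within D of w0.  The circle
   |w - w0| = 2^n D is at distance of order n from there, hence for n large in
   terms of K all four images stay inside it.  Inside, the metric is comparable
   to the Euclidean one and the images have length at most C(K) D; two of them
   are crosscuts joining the a-sides and the b-sides.

   No regularity of the derivative is needed: as in Goursat's lemma, bisection
   yields finitely many squares on each of which the map is close to an affine
   one, so that the squared diameter of the image of a square is bounded by the
   area of a square inside this image. *)
Require Import Defs.
From HB Require Import structures.
From mathcomp Require Import all_boot all_order all_algebra.
From mathcomp Require Import all_classical all_reals all_analysis.
From mathcomp Require Import measurable_realfun complex.
From mathcomp Require Import ring lra zify.

Import Order.TTheory GRing.Theory Num.Theory.
Import numFieldNormedType.Exports.
Import ComplexField.Normc.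

Local Open Scope classical_set_scope.
Local Open Scope ring_scope.
Local Open Scope complex_scope.

(** Finitely many squares cover only a compact part of the rectangle, and a polygon inscribed in the
    image of a line is under control only if the squares are fine compared with the spacing 1/N of
    its nodes. So each N has its own covering and its own good lines, but one bound serves all N.
    Along N = 2^k the polygon lengths of a fixed line increase and the lines stay in a compact
    strip, so a cluster point of the good lines keeps the bound for every k. Continuity up to the
    boundary supplies the missing ends.

    The number of scales is n = m^2. The weights have square sum O(n) and the squared image radii
    have sum O(M), so lines of weighted length [A] = mB exist. A point of the two lines kept is
    reached through at most three lines, each costing 2A, and 6A < n fixes m in terms of B, hence of
    K.

    A zero of the derivative is not excluded beforehand. There no square inside the image is
    available, and a small multiple [eta] of the area of the square itself pays for the image. *)

(** * Weighted coverings and packings by intervals and squares *)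

Section WeightedIntervals.
Variables (R : realType) (T : Type).
Implicit Types (L : seq T) (c p e : T -> R).
Local Notation mu := (@lebesgue_measure R).
Local Notation mR := (measurableTypeR R).

Lemma integral_sum_indic L c (J : T -> set mR) (D : set mR) :
  (forall q, 0 <= c q) -> (forall q, measurable (J q)) -> measurable D ->
  (\int[mu]_(x in D) (\sum_(q <- L) c q * \1_(J q) x)%:E =
   \sum_(q <- L) (c q)%:E * mu (J q `&` D))%E.
Proof.
move=> c0 mJ mD.
under eq_integral do rewrite -sumEFin.
rewrite ge0_integral_sum//=.
- apply: eq_bigr => q _.
  under eq_integral do rewrite EFinM.
  rewrite ge0_integralZl//=.
  + by rewrite integral_indic.
  + by apply/measurable_EFinP; exact: measurable_indic.
  + by rewrite lee_fin.
- move=> q; apply/measurable_EFinP; apply: measurable_funM => //.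
- by move=> q x _; rewrite lee_fin mulr_ge0.
Qed.

Lemma measurable_sum_indic L c (J : T -> set mR) (D : set mR) :
  (forall q, measurable (J q)) ->
  measurable_fun D (fun x => (\sum_(q <- L) c q * \1_(J q) x)%:E).
Proof.
move=> mJ; apply/measurable_EFinP.
elim: L => [|q L ih]; first by under eq_fun do rewrite big_nil; exact: measurable_cst.
under eq_fun do rewrite big_cons.
by apply: measurable_funD => //; apply: measurable_funM.
Qed.

Lemma integral_cst_itv (a b B : R) : a <= b ->
  (\int[mu]_(x in `[a, b]) B%:E = (B * (b - a))%:E)%E.
Proof.
move=> ab; rewrite integral_cst//= lebesgue_measure_itv/= lte_fin.
case: ltP => [_|ba]; first by rewrite EFinM EFinB.
have -> : a = b by apply/le_anti; rewrite ab ba.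
by rewrite subrr mulr0 mule0.
Qed.

Lemma sum_indic L c (J : T -> set mR) (b : T -> R -> bool) x :
  (forall q, J q x <-> b q x) ->
  \sum_(q <- L) c q * \1_(J q) x = \sum_(q <- L | b q x) c q.
Proof.
move=> Jb; rewrite [RHS]big_mkcond; apply: eq_bigr => q _.
rewrite indicE; case: ifPn => bq.
  by rewrite mem_set ?mulr1//; apply/Jb.
by rewrite memNset ?mulr0// => /Jb; rewrite (negbTE bq).
Qed.

(** Integrate the pointwise lower bound over [[a, b]]. This is used in two ways: with [x] a
    coordinate in the rectangle it is the averaging over lines, with [x] a value of a function it
    bounds an oscillation. *)
Lemma weighted_cover_le L c p e (P : pred T) (a b B : R) :
  a <= b -> (forall q, 0 <= c q) -> (forall q, 0 <= e q) ->
  (forall x, a <= x <= b ->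
     B <= \sum_(q <- L | P q && (`|x - p q| <= e q)) c q) ->
  B * (b - a) <= \sum_(q <- L | P q) c q * (2 * e q).
Proof.
move=> ab c0 e0 cover.
have [B0|B0] := ltP B 0.
  rewrite (@le_trans _ _ 0)//; first by rewrite nmulr_rle0 ?subr_ge0.
  by apply: sumr_ge0 => q _; rewrite mulr_ge0 ?mulr_ge0.
pose J q : set mR := `[p q - e q, p q + e q]%classic.
have JP q x : J q x <-> `|x - p q| <= e q.
  by rewrite /J/= in_itv/= ler_distl.
rewrite -[X in _ <= X]big_filter.
pose L' := [seq q <- L | P q].
have := @integral_sum_indic L' c J `[a, b]%classic c0
    (fun q => measurable_itv _) (measurable_itv _).
move=> E.
rewrite -lee_fin.
apply: (@le_trans _ _ (\int[mu]_(x in `[a, b]) B%:E)%E).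
  by rewrite integral_cst_itv.
apply: (@le_trans _ _ (\int[mu]_(x in `[a, b])
    (\sum_(q <- L') c q * \1_(J q) x)%:E)%E).
  apply: ge0_le_integral => //=.
  + apply: measurable_sum_indic => q; exact: measurable_itv.
  + move=> x; rewrite /= in_itv/= => xab; rewrite lee_fin.
    rewrite (sum_indic _ _ _ (fun q x => `|x - p q| <= e q))//.
    by rewrite /L' big_filter_cond; exact: cover.
rewrite E -sumEFin; apply: lee_sum => q _.
rewrite EFinM lee_wpmul2l ?lee_fin//.
apply: (@le_trans _ _ (mu (J q))).
  apply: le_measure; rewrite ?inE.
  + by apply: measurableI; exact: measurable_itv.
  + exact: measurable_itv.
  + exact: subIsetl.
rewrite /J lebesgue_measure_itv/= lte_fin; case: ifPn => _.
  by rewrite -EFinB lee_fin; lra.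
by rewrite lee_fin mulr_ge0.
Qed.

Lemma weighted_packing_le L c p e (P : pred T) (a b B : R) :
  a <= b -> 0 <= B -> (forall q, 0 <= c q) ->
  (forall q, P q -> a <= p q - e q /\ p q + e q <= b) ->
  (forall x, \sum_(q <- L | P q && (`|x - p q| < e q)) c q <= B) ->
  \sum_(q <- L | P q) c q * (2 * e q) <= B * (b - a).
Proof.
move=> ab B0 c0 inab pack.
pose J q : set mR := `]p q - e q, p q + e q[%classic.
have JP q x : J q x <-> `|x - p q| < e q.
  by rewrite /J/= in_itv/= ltr_distl.
pose L' := [seq q <- L | P q].
have E := @integral_sum_indic L' c J `[a, b]%classic c0
    (fun q => measurable_itv _) (measurable_itv _).
rewrite -lee_fin.
apply: (@le_trans _ _ (\int[mu]_(x in `[a, b]) B%:E)%E); last first.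
  by rewrite integral_cst_itv.
apply: (@le_trans _ _ (\int[mu]_(x in `[a, b])
    (\sum_(q <- L') c q * \1_(J q) x)%:E)%E); last first.
  apply: ge0_le_integral => //=.
  + by move=> x _; rewrite lee_fin sumr_ge0// => q _; rewrite mulr_ge0.
  + by apply: measurable_sum_indic => q; exact: measurable_itv.
  + move=> x _; rewrite lee_fin.
    rewrite (sum_indic _ _ _ (fun q x => `|x - p q| < e q))//.
    by rewrite /L' big_filter_cond.
rewrite E /L' big_filter -sumEFin; apply: lee_sum => q /inab [aq qb].
rewrite EFinM lee_wpmul2l ?lee_fin//.
have -> : J q `&` `[a, b] = J q.
  by apply/setIidPl => x; rewrite /J/= !in_itv/= => /andP[? ?]; apply/andP; split; lra.
rewrite /J lebesgue_measure_itv/= lte_fin; case: ifPn => [_|].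
  by rewrite -EFinB lee_fin; lra.
by rewrite lee_fin -leNgt; lra.
Qed.

(** Fubini for finite sums: the interval packing bound in the first coordinate with weights
    [2 * s q], whose hypothesis at each [x] is the packing bound in the second coordinate. *)
Lemma square_packing_le L (p1 p2 s : T -> R) (P : pred T) (a b a' b' : R) :
  a <= b -> a' <= b' -> (forall q, 0 <= s q) ->
  (forall q, P q -> a <= p1 q - s q /\ p1 q + s q <= b) ->
  (forall q, P q -> a' <= p2 q - s q /\ p2 q + s q <= b') ->
  (forall x y, \sum_(q <- L | P q && (`|x - p1 q| < s q) && (`|y - p2 q| < s q))
     1 <= 1 :> R) ->
  \sum_(q <- L | P q) 4 * s q ^+ 2 <= (b - a) * (b' - a').
Proof.
move=> ab ab' s0 in1 in2 pack.
have -> : \sum_(q <- L | P q) 4 * s q ^+ 2 = \sum_(q <- L | P q) (2 * s q) * (2 * s q).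
  by apply: eq_bigr => q _; ring.
rewrite [leRHS]mulrC.
apply: (weighted_packing_le _ _ p1) => //; first by rewrite subr_ge0.
  by move=> q; rewrite mulr_ge0.
move=> x; have -> : b' - a' = 1 * (b' - a') by rewrite mul1r.
under eq_bigr do rewrite -[2 * _]mul1r.
apply: (weighted_packing_le _ _ p2) => //.
by move=> q /andP[/in2].
Qed.

End WeightedIntervals.

(** * Subdivision of a square subordinate to a gauge *)

Section Cousin.
Variable R : realType.
Local Notation square := (R * R * R)%type.
Implicit Types (q : square) (x y : R).

(* [(a, b, r)] stands for the square [a, a + r] x [b, b + r]. *)
Definition in_square q x y : bool :=
  (q.1.1 <= x <= q.1.1 + q.2) && (q.1.2 <= y <= q.1.2 + q.2).
Definition in_interior q x y : bool :=
  (q.1.1 < x < q.1.1 + q.2) && (q.1.2 < y < q.1.2 + q.2).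

Definition quarters q : seq square :=
  let: (a, b, r) := q in
  let r' := r / 2 in
  [:: (a, b, r'); (a + r', b, r'); (a, b + r', r'); (a + r', b + r', r')].

(** Overlaps are counted against the indicator of the open square rather than against 1, so that the
    counts of the four quarters add up to the count for the whole square. *)
Definition subdivided (P : square -> Prop) q :=
  exists L : seq square,
  [/\ forall q', q' \in L -> P q' /\ 0 < q'.2,
      forall x y, in_square q x y -> exists2 q', q' \in L & in_square q' x y &
      forall x y, \sum_(q' <- L | in_interior q' x y) 1
                  <= (in_interior q x y)%:R :> R].

Lemma subdivided_quarters P q : 0 < q.2 ->
  (forall q', q' \in quarters q -> subdivided P q') -> subdivided P q.
Proof.
case: q => [[a b] r] /= r0 H.
have [|L1 [P1 C1 I1]] := H (a, b, r/2); first by rewrite !inE eqxx.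
have [|L2 [P2 C2 I2]] := H (a + r/2, b, r/2); first by rewrite !inE eqxx !orbT.
have [|L3 [P3 C3 I3]] := H (a, b + r/2, r/2); first by rewrite !inE eqxx !orbT.
have [|L4 [P4 C4 I4]] := H (a + r/2, b + r/2, r/2); first by rewrite !inE eqxx !orbT.
exists (L1 ++ L2 ++ L3 ++ L4); split.
- by move=> q'; rewrite !mem_cat => /or4P[/P1|/P2|/P3|/P4].
- move=> x y; rewrite /in_square/= => /andP[/andP[ax xa] /andP[bY yb]].
  have [xl|xl] := leP x (a + r/2); have [yl|yl] := leP y (b + r/2).
  + have [|q' q'L ?] := C1 x y; first by rewrite /in_square/= ax xl bY yl.
    by exists q' => //; rewrite !mem_cat q'L.
  + have [|q' q'L ?] := C3 x y.
      by rewrite /in_square/= ax xl/=; apply/andP; split; lra.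
    by exists q' => //; rewrite !mem_cat q'L !orbT.
  + have [|q' q'L ?] := C2 x y.
      by rewrite /in_square/= bY yl andbT; apply/andP; split; lra.
    by exists q' => //; rewrite !mem_cat q'L !orbT.
  + have [|q' q'L ?] := C4 x y.
      by rewrite /in_square/=; apply/andP; split; apply/andP; split; lra.
    by exists q' => //; rewrite !mem_cat q'L !orbT.
- move=> x y; rewrite !big_cat/=.
  apply: le_trans (lerD (I1 x y) (lerD (I2 x y) (lerD (I3 x y) (I4 x y)))) _.
  rewrite /in_interior/=.
  have [xl|xl] := ltP x (a + r/2); have [yl|yl] := ltP y (b + r/2).
  + rewrite (ltNge (a + r/2) x) (ltW xl) (ltNge (b + r/2) y) (ltW yl)/= !andbF !addr0.
    have -> : x < a + r by lra.
    by have -> : y < b + r by lra.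
  + rewrite (ltNge (a + r/2) x) (ltW xl) !andbF/= !add0r addr0 !andbT.
    have -> : x < a + r by lra.
    have -> : y < b + r/2 + r/2 = (y < b + r) by congr (_ < _); lra.
    rewrite ler_nat andbT; case: (a < x) => //=.
    by case: ltP => //= h; case: (y < b + r) => //=; case: ltP => //; lra.
  + rewrite (ltNge (b + r/2) y) (ltW yl) !andbF/= !add0r !addr0 !andbT.
    have -> : y < b + r by lra.
    have -> : x < a + r/2 + r/2 = (x < a + r) by congr (_ < _); lra.
    rewrite ler_nat andbT; case: (b < y) => //=; rewrite ?andbT ?andbF//.
    by case: ltP => //= h; case: (x < a + r) => //=; case: ltP => //; lra.
  + rewrite !andbF/= !add0r.
    have -> : y < b + r/2 + r/2 = (y < b + r) by congr (_ < _); lra.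
    have -> : x < a + r/2 + r/2 = (x < a + r) by congr (_ < _); lra.
    rewrite ler_nat.
    case: ltP => //= h; case: (x < a + r) => //=; case: ltP => //= h'.
    have -> : a < x by lra.
    have -> : b < y by lra.
    by [].
Qed.

(** Cousin's lemma: a square without subdivision has a quarter without one. The nested squares
    obtained in this way shrink to a point, whose gauge makes a late square a subdivision of
    itself. *)
Lemma subdivision (P : square -> Prop) :
  (forall x y, exists2 d, 0 < d &
     forall q, 0 < q.2 < d -> in_square q x y -> P q) ->
  forall q, 0 < q.2 -> subdivided P q.
Proof.
move=> gauge q0 q00; apply: contrapT => nsub.
have step (q : square) : exists q', 0 < q.2 -> ~ subdivided P q ->
    [/\ 0 < q'.2, ~ subdivided P q', q'.2 = q.2 / 2,
        q.1.1 <= q'.1.1 /\ q'.1.1 + q'.2 <= q.1.1 + q.2 &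
        q.1.2 <= q'.1.2 /\ q'.1.2 + q'.2 <= q.1.2 + q.2].
  apply: contrapT => /forallNP H.
  have [q2 ns] : 0 < q.2 /\ ~ subdivided P q.
    by have := H q; move=> /not_implyP[? /not_implyP[]].
  apply: ns; apply: subdivided_quarters => // q' q'q.
  apply: contrapT => ns'; apply: (H q') => _ _.
  case: q q2 q'q {H} => [[a b] r] /= r0; rewrite !inE => /or4P[] /eqP E; subst q';
    by split => //=; try split; lra.
have [F FP] := choice step.
pose s n := iter n F q0.
have sP n : 0 < (s n).2 /\ ~ subdivided P (s n).
  by elim: n => [//|n [h1 h2]]; have [] := FP _ h1 h2.
have sS n := FP _ (sP n).1 (sP n).2.
have size_s n : (s n).2 = q0.2 / 2 ^+ n.
  elim: n => [|n ih]; first by rewrite expr0 divr1.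
  have [_ _ -> _ _] := sS n; rewrite ih exprS invfM; ring.
have mono m n : (m <= n)%N -> [/\ (s m).1.1 <= (s n).1.1,
    (s n).1.1 + (s n).2 <= (s m).1.1 + (s m).2, (s m).1.2 <= (s n).1.2 &
    (s n).1.2 + (s n).2 <= (s m).1.2 + (s m).2].
  move=> /subnK <-; elim: (n - m)%N => [|k [h1 h2 h3 h4]]; first by rewrite add0n.
  by have [_ _ _ [? ?] [? ?]] := sS (k + m)%N; rewrite addSn; split;
    [apply: le_trans h1 _|apply: le_trans h2|apply: le_trans h3 _|apply: le_trans h4].
have cross m n : (s m).1.1 <= (s n).1.1 + (s n).2 /\ (s m).1.2 <= (s n).1.2 + (s n).2.
  have [h1 _ h3 _] := mono _ _ (leq_maxl m n).
  have [_ h2 _ h4] := mono _ _ (leq_maxr m n).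
  have [h5 _] := sP (maxn m n).
  by split; lra.
pose X := [set (s n).1.1 | n in [set: nat]].
pose Y := [set (s n).1.2 | n in [set: nat]].
have X0 : X !=set0 by exists (s 0%N).1.1; exists 0%N.
have Y0 : Y !=set0 by exists (s 0%N).1.2; exists 0%N.
(* The lower left corners increase in both coordinates, so their suprema give a point common to all
   squares. *)
have XY n : in_square (s n) (sup X) (sup Y).
  have ubX : ubound X ((s n).1.1 + (s n).2) by move=> _ [m _ <-]; have [] := cross m n.
  have ubY : ubound Y ((s n).1.2 + (s n).2) by move=> _ [m _ <-]; have [] := cross m n.
  apply/andP; split; apply/andP; split.
  - by apply: ub_le_sup; [exists ((s n).1.1 + (s n).2)|exists n].
  - exact: ge_sup.
  - by apply: ub_le_sup; [exists ((s n).1.2 + (s n).2)|exists n].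
  - exact: ge_sup.
have [d d0 dP] := gauge (sup X) (sup Y).
have [n nd] : exists n, (s n).2 < d.
  have [n] := @near_infty_natSinv_expn_lt R (PosNum (divr_gt0 d0 q00)) => //.
  move=> _ /(_ n (leqnn n)) /=; rewrite ltr_pdivlMr// => h.
  by exists n; rewrite size_s; apply: le_lt_trans h; rewrite div1r mulrC.
have [sn0 nsub_n] := sP n; apply: nsub_n.
exists [:: s n]; split.
- move=> q'; rewrite inE => /eqP ->; split => //.
  by apply: dP => //; rewrite sn0.
- by move=> x y h; exists (s n); rewrite ?inE.
- by move=> x y; rewrite big_mkcond big_seq1; case: ifP.
Qed.

End Cousin.

(** * Modulus, neighbourhoods and continuity in the plane *)

Section PlaneTopology.
Variable R : realType.
Local Notation C := (plane R).
Implicit Types (z w c : C) (A : set C).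

Lemma normc_ge0 z : 0 <= normc z.
Proof. by case: z => x y; exact: sqrtr_ge0. Qed.

Lemma normr_plane z : `|z| = (normc z)%:C.
Proof. by rewrite normc_def; case: z. Qed.

Lemma normcD_le z w : normc (z + w) <= normc z + normc w.
Proof. by have := ler_normD z w; rewrite !normr_plane -rmorphD/= lecR. Qed.

Lemma normc_opp z : normc (- z) = normc z.
Proof. by apply: complexI; rewrite -!normr_plane normrN. Qed.

Lemma normc_sub z w : normc (z - w) = normc (w - z).
Proof. by rewrite -normc_opp opprB. Qed.

Lemma normcB_le w z c : normc (z - c) <= normc (z - w) + normc (w - c).
Proof. by rewrite (le_trans _ (normcD_le _ _))// addrA subrK. Qed.

Lemma normcB_le_norm z w : `|normc z - normc w| <= normc (z - w).
Proof.
rewrite ler_norml; have := normcD_le (z - w) w; have := normcD_le (w - z) z.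
rewrite !subrK normc_sub; lra.
Qed.

Lemma Re_le_normc z : `|complex.Re z| <= normc z.
Proof.
case: z => x y /=; rewrite -sqrtr_sqr ler_wsqrtr// lerDl sqr_ge0//.
Qed.

Lemma Im_le_normc z : `|complex.Im z| <= normc z.
Proof.
case: z => x y /=; rewrite -sqrtr_sqr ler_wsqrtr// lerDr sqr_ge0//.
Qed.

Lemma normc_le_ReIm z : normc z <= `|complex.Re z| + `|complex.Im z|.
Proof.
case: z => x y /=.
rewrite -[leRHS]ger0_norm ?addr_ge0// -[leRHS]sqrtr_sqr ler_wsqrtr//.
rewrite sqrrD !real_normK ?num_real//.
have : 0 <= `|x| * `|y| *+ 2 by rewrite mulrn_wge0// mulr_ge0.
by lra.
Qed.

Lemma ReB z w : complex.Re (z - w) = complex.Re z - complex.Re w.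
Proof. by case: z w => [? ?] [? ?]. Qed.

Lemma ImB z w : complex.Im (z - w) = complex.Im z - complex.Im w.
Proof. by case: z w => [? ?] [? ?]. Qed.

Lemma complex_gt0P (e : C) : 0 < e -> e = (complex.Re e)%:C /\ 0 < complex.Re e.
Proof. by case: e => x y; rewrite ltcE/= => /andP[/eqP-> ?]. Qed.

(** Balls of the plane have radii in [R[i]]; a positive complex number is real, which allows real
    radii everywhere below. *)
Lemma nbhs_normcP c A :
  nbhs c A <-> exists2 e : R, 0 < e & forall w, normc (w - c) < e -> A w.
Proof.
rewrite nbhs_ballP; split.
- move=> [e /= /complex_gt0P[eE e0] h]; exists (complex.Re e) => // w we.
  by apply: h; rewrite /ball/= normr_plane normc_sub eE ltcR.
- move=> [e e0 h]; exists e%:C; first by rewrite /= ltcR.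
  by move=> w; rewrite /ball/= normr_plane normc_sub ltcR => /h.
Qed.

Lemma ball_plane c (r : R) w : ball c r%:C w = (normc (w - c) < r) :> Prop.
Proof. by rewrite /ball/= normr_plane normc_sub ltcR. Qed.

Lemma within_normcP A (f : C -> C) c : {within A, continuous f} -> A c ->
  forall e : R, 0 < e -> exists2 d : R, 0 < d &
    forall w, A w -> normc (w - c) < d -> normc (f w - f c) < e.
Proof.
move=> /subspace_continuousP fA Ac e e0.
have : nbhs (f c) [set z | normc (z - f c) < e] by apply/nbhs_normcP; exists e.
move=> /(fA c Ac) /nbhs_normcP[d d0 h].
by exists d => // w Aw wd; exact: h.
Qed.

Lemma derivable_normc (f : C -> C) z : derivable f z 1 ->
  exists l : C, forall e : R, 0 < e -> exists2 d : R, 0 < d &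
    forall w, normc (w - z) < d ->
      normc (f w - f z - l * (w - z)) <= e * normc (w - z).
Proof.
move=> /cvg_ex[l /= fl]; exists l => e e0.
have : nbhs l [set y | normc (y - l) < e] by apply/nbhs_normcP; exists e.
move=> /fl /nbhs_normcP[d d0 h].
exists d => // w wd.
have [->|wz] := eqVneq w z.
  by rewrite !subrr mulr0 subrr normc0 mulr0.
have wz0 : w - z != 0 by rewrite subr_eq0.
have := h (w - z); rewrite subr0 => /(_ wd wz0); rewrite /= /GRing.scale/= mulr1 subrK.
have -> : f w - f z - l * (w - z) = ((w - z)^-1 * (f w - f z) - l) * (w - z).
  by rewrite mulrBl mulrAC mulVf// mul1r.
by rewrite normcM => /ltW k; rewrite ler_wpM2r// normc_ge0.
Qed.

Lemma open_normcP A : open A ->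
  forall c, A c -> exists2 e : R, 0 < e & forall w, normc (w - c) < e -> A w.
Proof. by move=> oA c Ac; apply/nbhs_normcP; exact: open_nbhs_nbhs. Qed.

Lemma closure_normcP A c : ~ closure A c ->
  exists2 e : R, 0 < e & forall w, A w -> ~~ (normc (w - c) < e).
Proof.
move=> /existsNP[B /not_implyP[/nbhs_normcP[e e0 h] /forallNP nB]].
by exists e => // w Aw; apply/negP => /h Bw; exact: (nB w).
Qed.

Lemma lipschitz_continuous (f : C -> R) :
  (forall z w, `|f z - f w| <= normc (z - w)) -> continuous f.
Proof.
move=> lf z B /nbhs_ballP[e /= e0 h]; apply/nbhs_normcP; exists e => // w we.
apply: h; rewrite /ball/=.
by apply: le_lt_trans (lf z w) _; rewrite normc_sub.
Qed.

Lemma continuous_Re : continuous (@complex.Re R : C -> R).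
Proof. by apply: lipschitz_continuous => z w; rewrite -ReB Re_le_normc. Qed.

Lemma continuous_Im : continuous (@complex.Im R : C -> R).
Proof. by apply: lipschitz_continuous => z w; rewrite -ImB Im_le_normc. Qed.

Lemma continuous_normcB c : continuous (fun z : C => normc (z - c)).
Proof.
apply: lipschitz_continuous => z w; apply: le_trans (normcB_le_norm _ _) _.
by rewrite opprD opprK addrACA addNr addr0.
Qed.

Lemma continuous_Complex (T : topologicalType) (x y : T -> R) :
  continuous x -> continuous y -> continuous (fun t => (x t +i* y t : C)).
Proof.
move=> cx cy t B /nbhs_normcP[e e0 h].
have e2 : 0 < e / 2 by rewrite divr_gt0.
have /cvgrPdist_lt/(_ (e / 2)) := cx t; move=> /(_ e2) X.
have /cvgrPdist_lt/(_ (e / 2)) := cy t; move=> /(_ e2) Y.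
rewrite /nbhs/=; near=> u; apply: h.
apply: le_lt_trans (normc_le_ReIm _) _; rewrite ReB ImB/= distrC [X in _ + X]distrC.
have : `|x t - x u| < e / 2 by near: u.
have : `|y t - y u| < e / 2 by near: u.
by lra.
Unshelve. all: by end_near. Qed.

Lemma continuous_fun_comp (T U V : topologicalType) (f : T -> U) (g : U -> V) :
  continuous f -> continuous g -> continuous (fun t => g (f t)).
Proof. by move=> cf cg t; exact: (continuous_comp (cf t) (cg (f t))). Qed.

Lemma continuous_addr (T : topologicalType) (x y : T -> R) :
  continuous x -> continuous y -> continuous (fun t => x t + y t).
Proof. by move=> cx cy t; apply: cvgD; [exact: cx|exact: cy]. Qed.

Lemma continuous_maxr (T : topologicalType) (x y : T -> R) :
  continuous x -> continuous y -> continuous (fun t => Num.max (x t) (y t)).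
Proof.
move=> cx cy t; under eq_fun do rewrite maxr_absE.
apply: cvgM; last exact: cvg_cst.
apply: cvgD; first by apply: cvgD; [exact: cx|exact: cy].
by apply: cvg_norm; apply: cvgB; [exact: cx|exact: cy].
Qed.

Lemma continuous_minr (T : topologicalType) (x y : T -> R) :
  continuous x -> continuous y -> continuous (fun t => Num.min (x t) (y t)).
Proof.
move=> cx cy t; under eq_fun do rewrite minr_absE.
apply: cvgM; last exact: cvg_cst.
apply: cvgB; first by apply: cvgD; [exact: cx|exact: cy].
by apply: cvg_norm; apply: cvgB; [exact: cx|exact: cy].
Qed.

End PlaneTopology.

(** * Axis-parallel squares in the complex plane *)

Section Squares.
Variable R : realType.
Local Notation C := (plane R).
Local Notation square := (R * R * R)%type.
Implicit Types (q : square) (z w c : C).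

Definition sq_center q : C := (q.1.1 + q.2 / 2) +i* (q.1.2 + q.2 / 2).

Definition in_sq q w : bool := in_square R q (complex.Re w) (complex.Im w).

Definition in_int q w : bool := in_interior R q (complex.Re w) (complex.Im w).

Lemma in_sq_dist q z w : in_sq q z -> in_sq q w -> normc (z - w) <= 2 * q.2.
Proof.
rewrite /in_sq /in_square => /andP[/andP[? ?] /andP[? ?]] /andP[/andP[? ?] /andP[? ?]].
apply: le_trans (normc_le_ReIm _ _) _; rewrite ReB ImB.
have : `|complex.Re z - complex.Re w| <= q.2 by rewrite ler_norml; lra.
have : `|complex.Im z - complex.Im w| <= q.2 by rewrite ler_norml; lra.
lra.
Qed.

Lemma in_sq_center q : 0 <= q.2 -> in_sq q (sq_center q).
Proof. by move=> q0; rewrite /in_sq /in_square/=; apply/andP; split; lra. Qed.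

Lemma in_sq_dist_center q w : in_sq q w -> normc (w - sq_center q) <= q.2.
Proof.
rewrite /in_sq /in_square => /andP[/andP[? ?] /andP[? ?]].
apply: le_trans (normc_le_ReIm _ _) _; rewrite ReB ImB/=.
have : `|complex.Re w - (q.1.1 + q.2 / 2)| <= q.2 / 2 by rewrite ler_norml; lra.
have : `|complex.Im w - (q.1.2 + q.2 / 2)| <= q.2 / 2 by rewrite ler_norml; lra.
lra.
Qed.

Lemma squares_area (L : seq square) (P : pred square) (x0 y0 h : R) :
  0 <= h ->
  (forall q, P q -> [/\ 0 < q.2,
    `|q.1.1 + q.2 / 2 - x0| + q.2 / 2 <= h &
    `|q.1.2 + q.2 / 2 - y0| + q.2 / 2 <= h]) ->
  (forall x y, \sum_(q <- L | in_interior R q x y) 1 <= 1 :> R) ->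
  \sum_(q <- L | P q) q.2 ^+ 2 <= (2 * h) ^+ 2.
Proof.
move=> h0 inP pack.
(* The packing lemma wants nonnegative half-sides for all triples, also those outside [P]; hence the
   absolute value. *)
have -> : \sum_(q <- L | P q) q.2 ^+ 2 = \sum_(q <- L | P q) 4 * (`|q.2| / 2) ^+ 2.
  apply: eq_bigr => q _.
  by rewrite expr_div_n real_normK ?num_real// -natrX mulrC divfK// pnatr_eq0.
have -> : (2 * h) ^+ 2 = (x0 + h - (x0 - h)) * (y0 + h - (y0 - h)) by ring.
apply: (square_packing_le R _ L (fun q => q.1.1 + q.2 / 2) (fun q => q.1.2 + q.2 / 2)).
- by lra.
- by lra.
- by move=> q; rewrite divr_ge0.
- move=> q /inP[q0 + _]; rewrite (gtr0_norm q0).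
  have := ler_norm (q.1.1 + q.2 / 2 - x0).
  have := ler_norm (- (q.1.1 + q.2 / 2 - x0)); rewrite normrN => *.
  by split; lra.
- move=> q /inP[q0 _]; rewrite (gtr0_norm q0).
  have := ler_norm (q.1.2 + q.2 / 2 - y0).
  have := ler_norm (- (q.1.2 + q.2 / 2 - y0)); rewrite normrN => *.
  by split; lra.
- move=> x y; apply: le_trans (pack x y).
  rewrite big_mkcond [leRHS]big_mkcond/=; apply: ler_sum => q _.
  case: ifPn => [/andP[/andP[/inP[q0 _ _]]]|_]; last by case: ifP.
  rewrite (gtr0_norm q0) !ltr_distl => /andP[? ?] /andP[? ?].
  rewrite ifT// /in_interior; apply/andP; split; apply/andP; split; lra.
Qed.

End Squares.

(** * Distortion of small squares by a conformal map onto a rectangle *)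

Section ConformalChart.
Variable R : realType.
Local Notation C := (plane R).
Local Notation square := (R * R * R)%type.
Local Notation Re := (@complex.Re R).
Local Notation Im := (@complex.Im R).
Implicit Types (q : square) (z w c : C).

Definition open_rect (M : R) z : bool := (0 < Re z < M) && (0 < Im z < 1).

Definition inner_rect (M t : R) z : bool :=
  (t <= Re z <= M - t) && (t <= Im z <= 1 - t).

Lemma inner_rect_open (M t : R) z : 0 < t -> inner_rect M t z -> open_rect M z.
Proof.
move=> t0 /andP[/andP[? ?] /andP[? ?]].
by rewrite /open_rect; apply/andP; split; apply/andP; split; lra.
Qed.

(* [G] extends the inverse of [phi] to a continuous map of the whole plane. *)
Record conformal_chart (Q : set C) (phi G : C -> C) (M : R) : Prop := {
  chart_gt0 : 0 < M ;
  chart_open : forall c, Q c ->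
    exists2 d : R, 0 < d & forall w, normc (w - c) < d -> Q w ;
  chart_diff : forall c, Q c -> exists l : C, forall e : R, 0 < e ->
    exists2 d : R, 0 < d & forall w, normc (w - c) < d ->
      normc (phi w - phi c - l * (w - c)) <= e * normc (w - c) ;
  chart_dom : forall w, Q w -> open_rect M (phi w) /\ G (phi w) = w ;
  chart_inv : forall z, open_rect M z -> Q (G z) /\ phi (G z) = z ;
  chart_out : forall c, ~ Q c -> forall t : R, 0 < t ->
    exists2 d : R, 0 < d & forall w, Q w -> normc (w - c) < d ->
      ~~ inner_rect M t (phi w) ;
  chart_cont : continuous G ;
  chart_bounded : exists B : R, forall w, Q w -> normc w <= B }.

Variables (Q : set C) (phi G : C -> C) (M : R).
Hypothesis chart : conformal_chart Q phi G M.

(* The preimage of a segment issued from the image of the center stays off the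
   boundary of the square, whose image is too far away. *)
Lemma square_image q (l : R) : 0 < q.2 ->
  (forall w, in_sq R q w -> Q w) ->
  (forall w, in_sq R q w -> q.2 / 2 <= normc (w - sq_center R q) ->
     3 / 8 * l * q.2 <= normc (phi w - phi (sq_center R q))) ->
  (forall z, `|Re z - Re (phi (sq_center R q))| < l * q.2 / 8 ->
     `|Im z - Im (phi (sq_center R q))| < l * q.2 / 8 -> open_rect M z) ->
  forall z, `|Re z - Re (phi (sq_center R q))| < l * q.2 / 8 ->
    `|Im z - Im (phi (sq_center R q))| < l * q.2 / 8 -> in_int R q (G z).
Proof.
set m := sq_center R q; move=> q0 qQ border inR z zx zy.
have s0 : 0 < l * q.2 / 8 by apply: le_lt_trans zx.
have Qm : Q m by apply/qQ/in_sq_center/ltW.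
pose zt t : C := (Re (phi m) + t * (Re z - Re (phi m))) +i*
                 (Im (phi m) + t * (Im z - Im (phi m))).
have zt_cont : continuous zt.
  apply: continuous_Complex => t; apply: cvgD; try exact: cvg_cst;
    by apply: cvgM; [exact: cvg_id|exact: cvg_cst].
have zt_near t : 0 <= t <= 1 -> `|Re (zt t) - Re (phi m)| < l * q.2 / 8 /\
    `|Im (zt t) - Im (phi m)| < l * q.2 / 8.
  move=> /andP[t0 t1] /=; rewrite ![_ + t * _ - _]addrAC !subrr !add0r !normrM ger0_norm//.
  by split; [apply: le_lt_trans zx|apply: le_lt_trans zy]; rewrite ler_piMl.
pose k t : R := Num.max `|Re (G (zt t)) - Re m| `|Im (G (zt t)) - Im m|.
have ReG_cont : continuous (fun t => Re (G (zt t))).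
  exact: (continuous_fun_comp _ _ _ _ _ (continuous_fun_comp _ _ _ _ _ zt_cont
    (chart_cont _ _ _ _ chart)) (@continuous_Re R)).
have ImG_cont : continuous (fun t => Im (G (zt t))).
  exact: (continuous_fun_comp _ _ _ _ _ (continuous_fun_comp _ _ _ _ _ zt_cont
    (chart_cont _ _ _ _ chart)) (@continuous_Im R)).
have k_cont : continuous k.
  apply: continuous_maxr => t; apply: cvg_norm; apply: cvgB; try exact: cvg_cst.
    exact: ReG_cont.
  exact: ImG_cont.
have zt0 : zt 0 = phi m by rewrite /zt !mul0r !addr0; case: (phi m).
have zt1 : zt 1 = z.
  by rewrite /zt !mul1r !(addrC _ (_ - _)) !subrK; case: (z).
have k0 : k 0 = 0.
  by rewrite /k zt0; have [_ ->] := chart_dom _ _ _ _ chart _ Qm; rewrite !subrr normr0 maxxx.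
have [k1|k1] := ltP (k 1) (q.2 / 2).
  move: k1; rewrite /k zt1 gt_max /m/= !ltr_distl => /andP[/andP[? ?] /andP[? ?]].
  by rewrite /in_int /in_interior; apply/andP; split; apply/andP; split; lra.
have [t t01 kt] : exists2 t, t \in `[0, 1] & k t = q.2 / 2.
  apply: IVT => //; first exact: continuous_subspaceT.
  by rewrite k0 ge_min le_max k1 orbT divr_ge0// ltW.
move: t01; rewrite in_itv/= => t01.
have [ztx zty] := zt_near t t01.
have [_ phiG] := chart_inv _ _ _ _ chart _ (inR _ ztx zty).
have [kx ky] : `|Re (G (zt t)) - Re m| <= q.2 / 2 /\ `|Im (G (zt t)) - Im m| <= q.2 / 2.
  by rewrite -kt /k !le_max !lexx orbT.
have inq : in_sq R q (G (zt t)).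
  move: kx ky; clear - q0; rewrite !ler_distl /m/= => /andP[? ?] /andP[? ?].
  by rewrite /in_sq /in_square; apply/andP; split; apply/andP; split; lra.
have : q.2 / 2 <= normc (G (zt t) - m).
  by rewrite -kt /k ge_max -ReB -ImB Re_le_normc Im_le_normc.
move=> /(border _ inq); rewrite phiG.
have := normc_le_ReIm _ (zt t - phi m); rewrite ReB ImB.
by lra.
Qed.

(* [es = (e, s)]: the image of [q] has radius at most [e], and contains the
   open square of half-side [s] around the image of the center of [q]. *)
Definition good_square (nu mu eta : R) q (es : R * R) : Prop :=
  [/\ 0 < q.2 <= mu, 0 <= es.1 <= nu /\ 0 <= es.2,
      es.1 ^+ 2 <= 256 * es.2 ^+ 2 + eta * q.2 ^+ 2,
      forall w, in_sq R q w -> Q w /\ normc (phi w - phi (sq_center R q)) <= es.1 &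
      [/\ 0 <= Re (phi (sq_center R q)) - es.2, Re (phi (sq_center R q)) + es.2 <= M,
          0 <= Im (phi (sq_center R q)) - es.2, Im (phi (sq_center R q)) + es.2 <= 1 &
          forall z, `|Re z - Re (phi (sq_center R q))| < es.2 ->
            `|Im z - Im (phi (sq_center R q))| < es.2 -> in_int R q (G z)]].

(** With derivative [l] nonzero at [c], the map is almost a similarity on a square of side r: the
    image has radius at most 2|l|r and contains a square of half-side |l|r/8. The ratio 16 is the
    origin of 256. With [l] zero the half-side is taken to be 0 and the term with [eta] bounds the
    radius. *)
Lemma good_square_near (nu mu eta : R) c : 0 < nu -> 0 < mu -> 0 < eta -> Q c ->
  exists2 d : R, 0 < d & forall q, 0 < q.2 < d -> in_sq R q c ->
    exists es, good_square nu mu eta q es.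
Proof.
move=> nu0 mu0 eta0 Qc.
have [dQ dQ0 dQP] := chart_open _ _ _ _ chart _ Qc.
have [l lP] := chart_diff _ _ _ _ chart _ Qc.
pose ell := normc l; have : 0 <= ell by exact: normc_ge0.
rewrite le_eqVlt => /predU1P[ell0|ell0].
  pose ep := Num.min 1 eta / 16.
  have ep0 : 0 < ep by rewrite divr_gt0// lt_min ltr01.
  have ep1 : ep <= 1 / 16 by rewrite ler_pM2r// ge_min lexx.
  have epe : ep <= eta / 16 by rewrite ler_pM2r// ge_min lexx orbT.
  have [d d0 dP] := lP _ ep0.
  exists (Num.min (Num.min (d / 2) (dQ / 2)) (Num.min mu nu)).
    by rewrite !lt_min !divr_gt0// mu0 nu0.
  move=> q /andP[q0]; rewrite !lt_min => /andP[/andP[qd qdQ] /andP[qmu qnu]] cq.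
  have inQ w : in_sq R q w -> Q w.
    by move=> wq; apply: dQP; have := in_sq_dist _ _ _ _ wq cq; lra.
  have bnd w : in_sq R q w -> normc (phi w - phi c) <= ep * (2 * q.2).
    move=> wq; have wc := in_sq_dist _ _ _ _ wq cq.
    have := dP w; rewrite (@eq0_normc _ l) ?mul0r ?subr0; last exact: esym ell0.
    move=> /(_ _) h; apply: le_trans (h _) _; first by lra.
    by rewrite ler_pM2l.
  have mq : in_sq R q (sq_center R q) by apply: in_sq_center; exact: ltW.
  have [/andP[/andP[? ?] /andP[? ?]] _] := chart_dom _ _ _ _ chart _ (inQ _ mq).
  have epq0 : 0 < ep * q.2 by rewrite mulr_gt0.
  have epq1 : ep * q.2 <= 1 / 16 * q.2 by rewrite ler_pM2r.
  exists (4 * ep * q.2, 0); split => /=.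
  - by rewrite q0 ltW.
  - by split=> //; apply/andP; split; lra.
  - rewrite expr0n mulr0 add0r.
    have -> : (4 * ep * q.2) ^+ 2 = 16 * ((ep * q.2) * (ep * q.2)) by ring.
    have -> : eta * q.2 ^+ 2 = 16 * ((1 / 16 * q.2) * (eta * q.2)) by field.
    rewrite ler_pM2l//; apply: ler_pM; [exact: ltW|exact: ltW|by rewrite ler_pM2r|].
    by rewrite ler_pM2r//; lra.
  - move=> w wq; split; first exact: inQ.
    apply: le_trans (normcB_le _ (phi c) _ _) _; rewrite (normc_sub _ (phi c)).
    by have := bnd _ wq; have := bnd _ mq; lra.
  - by rewrite !subr0 !addr0; split; [lra..|move=> z; rewrite ltNge normr_ge0].
(* A relative error of ell/64 becomes ell r/32 about [c], as points of the square are at most 2r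
   apart, and ell r/16 about the center. On the border this leaves at least 7/16 ell r, more than
   the 3/8 ell r that [square_image] asks for. *)
have [d d0 dP] := lP _ (divr_gt0 ell0 (ltr0Sn R 63)).
have [/andP[/andP[cx0 cxM] /andP[cy0 cy1]] _] := chart_dom _ _ _ _ chart _ Qc.
pose t0 := Num.min (Num.min (Re (phi c)) (M - Re (phi c)))
                   (Num.min (Im (phi c)) (1 - Im (phi c))).
have t00 : 0 < t0 by rewrite !lt_min cx0 cy0 !subr_gt0 cxM cy1.
(* The bound 4 ell r < min(nu, t0) covers the radius 2 ell r as well as the shift 3 ell r of the
   center plus the half-side ell r/8, so the inscribed square stays in the rectangle. *)
have e4 : 0 < 4 * ell by rewrite mulr_gt0.
exists (Num.min (Num.min (d / 2) (dQ / 2)) (Num.min mu (Num.min nu t0 / (4 * ell)))).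
  have nt : 0 < Num.min nu t0 by rewrite lt_min nu0.
  by rewrite !lt_min mu0 !divr_gt0.
move=> q /andP[q0]; rewrite !lt_min (ltr_pdivlMr _ _ e4) lt_min.
move=> /andP[/andP[qd qdQ] /andP[qmu /andP[qnu]]].
rewrite /t0 !lt_min => /andP[/andP[qx0 qxM] /andP[qy0 qy1]] cq.
have inQ w : in_sq R q w -> Q w.
  by move=> wq; apply: dQP; have := in_sq_dist _ _ _ _ wq cq; lra.
set m := sq_center R q.
have mq : in_sq R q m by apply: in_sq_center; exact: ltW.
have lin w : in_sq R q w -> normc (phi w - phi c - l * (w - c)) <= ell * q.2 / 32.
  move=> wq; have wc := in_sq_dist _ _ _ _ wq cq.
  apply: le_trans (dP w _) _; first by lra.
  have : ell * normc (w - c) <= ell * (2 * q.2) by rewrite ler_pM2l.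
  by lra.
have linm w : in_sq R q w -> normc (phi w - phi m - l * (w - m)) <= ell * q.2 / 16.
  move=> wq; have -> : phi w - phi m - l * (w - m) =
    (phi w - phi c - l * (w - c)) - (phi m - phi c - l * (m - c)) by ring.
  apply: le_trans (normcD_le _ _ _) _; rewrite normc_opp.
  by have := lin _ wq; have := lin _ mq; lra.
have normcl w : normc (l * w) = ell * normc w by rewrite normcM.
have elq : 0 < ell * q.2 by rewrite mulr_gt0.
have phim : normc (phi m - phi c) <= 3 * (ell * q.2).
  rewrite -[phi m - phi c](subrK (l * (m - c))).
  apply: le_trans (normcD_le _ _ _) _; rewrite normcl.
  have := lin _ mq.
  have : ell * normc (m - c) <= ell * (2 * q.2) by rewrite ler_pM2l// in_sq_dist.
  lra.
have phimx := le_trans (Re_le_normc _ _) phim.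
have phimy := le_trans (Im_le_normc _ _) phim.
move: phimx phimy; rewrite ReB ImB !ler_distl => /andP[mx1 mx2] /andP[my1 my2].
exists (2 * ell * q.2, ell * q.2 / 8); split => /=.
- by rewrite q0 ltW.
- split; last by lra.
  by clear - elq qnu; apply/andP; split; lra.
- have -> : (2 * ell * q.2) ^+ 2 = 256 * (ell * q.2 / 8) ^+ 2 by field.
  by rewrite lerDl mulr_ge0 ?sqr_ge0// ltW.
- move=> w wq; split; first exact: inQ.
  rewrite -/m -[phi w - phi m](subrK (l * (w - m))).
  apply: le_trans (normcD_le _ _ _) _; rewrite normcl.
  have := linm _ wq.
  have : ell * normc (w - m) <= ell * q.2 by rewrite ler_pM2l// in_sq_dist_center.
  lra.
- rewrite -/m; split; [clear - qx0 qxM qy0 qy1 mx1 mx2 my1 my2 elq; lra..|].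
  apply: square_image => // [w wq wm|z]; rewrite -/m.
    have := linm _ wq.
    have := normcB_le_norm _ (phi w - phi m) (l * (w - m)).
    rewrite normcl ler_norml.
    have : ell * (q.2 / 2) <= ell * normc (w - m) by rewrite ler_pM2l.
    lra.
  clear - qx0 qxM qy0 qy1 mx1 mx2 my1 my2 elq; rewrite !ltr_distl => /andP[? ?] /andP[? ?].
  by rewrite /open_rect; apply/andP; split; apply/andP; split; lra.
Qed.

End ConformalChart.

(** * Finite coverings with controlled image areas *)

Section StageCover.
Variable R : realType.
Local Notation C := (plane R).
Local Notation square := (R * R * R)%type.
Variables (Q : set C) (phi G : C -> C) (M : R).
Hypothesis chart : conformal_chart R Q phi G M.

(** The gauge gives good squares at points of [Q]; at other points it gives squares no point of
    which is mapped into the inner rectangle, and these can be discarded. In 65 M, the share 64 M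
    comes from the inscribed image squares, of area 4 s^2 and disjoint in a rectangle of area M,
    since 256 s^2 = 64 (4 s^2). The last M is the error term. *)
Lemma stage_cover (t nu mu : R) : 0 < t -> 0 < nu -> 0 < mu ->
  exists (L : seq square) (e : square -> R),
  [/\ forall q, q \in L -> 0 < q.2 <= mu /\ e q <= nu,
      forall q, 0 <= e q,
      forall q w, q \in L -> in_sq R q w ->
        Q w /\ normc (phi w - phi (sq_center R q)) <= e q,
      forall z, inner_rect R M t z -> exists2 q, q \in L & in_sq R q (G z) &
      (forall x y, \sum_(q <- L | in_interior R q x y) 1 <= 1 :> R) /\
      \sum_(q <- L) e q ^+ 2 <= 65 * M].
Proof.
move=> t0 nu0 mu0.
have M0 := chart_gt0 _ _ _ _ _ chart.
have [B0 B0P] := chart_bounded _ _ _ _ _ chart.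
pose B := `|B0| + 1.
have B_gt0 : 0 < B by rewrite ltr_wpDl.
have BP w : Q w -> normc w <= B.
  by move=> /B0P h; have := ler_norm B0; rewrite /B; lra.
pose h := B + mu.
have h0 : 0 < h by rewrite addr_gt0.
(* All good squares lie in a square of side [2 * h], so the errors [eta * q.2 ^+ 2] add up to at
   most [M]. *)
pose eta := M / (2 * h) ^+ 2.
have eta0 : 0 < eta by rewrite divr_gt0// exprn_gt0// mulr_gt0.
pose good q := `[< exists es, good_square R Q phi G M nu mu eta q es >].
pose P q := good q \/
  forall w, Q w -> in_sq R q w -> ~~ inner_rect R M t (phi w).
have gauge x y : exists2 d, 0 < d &
    forall q, 0 < q.2 < d -> in_square R q x y -> P q.
  have [Qc|nQc] := pselect (Q (x +i* y)).
    have [d d0 dP] := good_square_near _ _ _ _ _ chart _ _ _ _ nu0 mu0 eta0 Qc.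
    by exists d => // q qd qxy; left; apply/asboolP; exact: dP.
  have [d d0 dP] := chart_out _ _ _ _ _ chart _ nQc _ t0.
  exists (d / 2); first by rewrite divr_gt0.
  move=> q /andP[q0 qd] qxy; right => w Qw wq; apply: (dP w Qw).
  by have := in_sq_dist _ q w (x +i* y) wq qxy; lra.
have [|L0 [L0P L0cov L0count]] := subdivision R P gauge (- B, - B, 2 * B).
  by rewrite mulr_gt0.
(* Squares that are not good receive (0, 0), so that both numbers are nonnegative without a side
   condition. *)
have esE q : exists es : R * R, [/\ 0 <= es.1, 0 <= es.2 &
    good q -> good_square R Q phi G M nu mu eta q es].
  have [gq|] := boolP (good q); last by exists (0, 0).
  have /asboolP[es esq] := gq.
  by exists es; split => //; case: esq => _ [/andP[]].
have [es esP] := choice esE.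
have goodP q (gq : good q) : good_square R Q phi G M nu mu eta q (es q).
  by have [_ _] := esP q; exact.
exists [seq q <- L0 | good q], (fun q => (es q).1).
have count x y : \sum_(q <- L0 | in_interior R q x y) 1 <= 1 :> R.
  by apply: le_trans (L0count x y) _; case: (in_interior _ _ _ _).
split.
- by move=> q; rewrite mem_filter => /andP[/goodP[? [/andP[? ?] _] _ _ _] _].
- by move=> q; have [] := esP q.
- by move=> q w; rewrite mem_filter => /andP[/goodP[_ _ _ h1 _] _] /h1.
- move=> z zin.
  have zM : open_rect R M z := inner_rect_open _ _ _ _ t0 zin.
  have [QG phiG] := chart_inv _ _ _ _ _ chart _ zM.
  have [|q qL qG] := L0cov (complex.Re (G z)) (complex.Im (G z)).
    have := le_trans (Re_le_normc _ _) (BP _ QG).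
    have := le_trans (Im_le_normc _ _) (BP _ QG).
    rewrite !ler_norml => /andP[? ?] /andP[? ?].
    by rewrite /in_square/=; apply/andP; split; apply/andP; split; lra.
  exists q => //; rewrite mem_filter qL andbT.
  have [[//|nin] _] := L0P _ qL.
  by have := nin _ QG qG; rewrite phiG zin.
- split.
    move=> x y; rewrite big_filter_cond; apply: le_trans (count x y).
    rewrite big_mkcond [leRHS]big_mkcond/=; apply: ler_sum => q _.
    by case: (good q); case: (in_interior _ _ _ _).
  rewrite big_filter.
  apply: (@le_trans _ _ (\sum_(q <- L0 | good q)
      (64 * (4 * (es q).2 ^+ 2) + eta * q.2 ^+ 2))).
    apply: ler_sum => q /goodP[_ _ h1 _ _]; apply: le_trans h1 _.
    by rewrite mulrA -natrM.
  rewrite big_split/= -!mulr_sumr.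
  have A1 : \sum_(q <- L0 | good q) 4 * (es q).2 ^+ 2 <= (M - 0) * (1 - 0).
    apply: (square_packing_le _ _ _
      (fun q => complex.Re (phi (sq_center R q))) (fun q => complex.Im (phi (sq_center R q)))).
    + exact: ltW.
    + exact: ler01.
    + by move=> q; have [] := esP q.
    + by move=> q /goodP[_ _ _ _ [? ? _ _ _]]; split.
    + by move=> q /goodP[_ _ _ _ [_ _ ? ? _]]; split.
    + move=> x y.
      (* A point in several inscribed image squares would be sent by [G] into the interiors of as
         many squares of the subdivision. *)
      apply: le_trans (count (complex.Re (G (x +i* y))) (complex.Im (G (x +i* y)))).
      rewrite big_mkcond [leRHS]big_mkcond/=; apply: ler_sum => q _.
      case: ifPn => [/andP[/andP[/goodP[_ _ _ _ [_ _ _ _ inq]] xq] yq]|_]; last by case: ifP.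
      by rewrite ifT//; exact: (inq (x +i* y) xq yq).
  have A2 : \sum_(q <- L0 | good q) q.2 ^+ 2 <= (2 * h) ^+ 2.
    apply: (squares_area _ _ _ 0 0) => //; first exact: ltW.
    move=> q /goodP[/andP[q0 qmu] _ _ inQ _].
    have [Qm _] := inQ _ (in_sq_center _ q (ltW q0)).
    have := le_trans (Re_le_normc _ _) (BP _ Qm).
    have := le_trans (Im_le_normc _ _) (BP _ Qm).
    by rewrite /= !subr0 /h => ? ?; split => //; lra.
  have A3 : eta * \sum_(q <- L0 | good q) q.2 ^+ 2 <= M.
    by rewrite mulrC -ler_pdivlMr// /eta invf_div mulrC divfK ?gt_eqF.
  by move: A1; rewrite -mulr_sumr; lra.
Qed.

End StageCover.

(** * The truncated logarithmic potential and its discrete gradient *)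

Section Potential.
Variable R : realType.
Local Notation C := (plane R).
Local Notation square := (R * R * R)%type.
Variables (w0 : C) (D : R).
Hypothesis D_gt0 : 0 < D.

Definition ramp (k : nat) (w : C) : R :=
  Num.min 1 (Num.max 0 (normc (w - w0) / (2 ^+ k * D) - 1)).

(* A piecewise linear substitute for log_2 (|w - w0| / D), cut off at n. *)
Definition potential (n : nat) (w : C) : R := \sum_(k < n) ramp k w.

(** If this fails and the side is at most [D], then [ramp k] equals 1 on all of [q]: it is constant
    beyond radius 2^(k+1) D, and doubling that radius leaves room for the square. The full disk is
    taken instead of an annulus to make the condition monotone in [k]. *)
Definition near_disk (k : nat) (q : square) : bool :=
  normc (sq_center R q - w0) <= 2 ^+ k.+2 * D.

(** The k-th ramp has Lipschitz constant 1 / (2^k D), and only ramps that can vary on [q] are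
    counted. Up to constants this is the side of [q] in the metric of the length-area argument. The
    absolute value makes it nonnegative for every triple. *)
Definition weight (n : nat) (q : square) : R :=
  `|q.2| / D * \sum_(k < n) (near_disk k q)%:R / 2 ^+ k.

Let pD k : 0 < 2 ^+ k * D :> R. Proof. by rewrite mulr_gt0// exprn_gt0. Qed.

Lemma continuous_potential n : continuous (potential n).
Proof.
elim: n => [|n ih].
  have -> : potential 0 = fun=> 0 by apply/funext => w; rewrite /potential big_ord0.
  exact: cst_continuous.
have -> : potential n.+1 = fun w => potential n w + ramp n w.
  by apply/funext => w; rewrite /potential big_ord_recr.
apply: continuous_addr => //.
apply: (continuous_minr _ _ (fun=> 1)); first exact: cst_continuous.
apply: (continuous_maxr _ _ (fun=> 0)); first exact: cst_continuous.
apply: (continuous_fun_comp _ _ _ (fun w : C => normc (w - w0))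
  (fun x => x / (2 ^+ n * D) - 1)).
  exact: continuous_normcB.
move=> x; apply: cvgB; last exact: cvg_cst.
by apply: cvgM; [exact: cvg_id|exact: cvg_cst].
Qed.

Lemma potential_near n w : normc (w - w0) <= D -> potential n w = 0.
Proof.
move=> wD; rewrite /potential big1// => k _; rewrite /ramp.
rewrite max_l ?min_r// subr_le0 ler_pdivrMr// mul1r (le_trans wD)//.
by rewrite ler_peMl ?exprn_ege1 ?ler1n// ltW.
Qed.

Lemma ramp_eq1 k w : 2 ^+ k.+1 * D <= normc (w - w0) -> ramp k w = 1.
Proof.
move=> wD; rewrite /ramp min_l// le_max; apply/orP; right.
have : 2 <= normc (w - w0) / (2 ^+ k * D); last by lra.
by rewrite ler_pdivlMr// mulrA -exprS.
Qed.

Lemma potential_far n w : 2 ^+ n * D <= normc (w - w0) -> potential n w = n%:R.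
Proof.
move=> wD; rewrite /potential (eq_bigr (fun=> 1)); last first.
  move=> k _; apply: ramp_eq1; apply: le_trans wD.
  by rewrite ler_pM2r// ler_eXn2l// ltr1n.
by rewrite sumr_const card_ord.
Qed.

Lemma weight_ge0 n q : 0 <= weight n q.
Proof.
rewrite /weight mulr_ge0// ?divr_ge0// ?(ltW D_gt0)//.
by apply: sumr_ge0 => k _; rewrite divr_ge0// exprn_ge0.
Qed.

Lemma min1_max0_lip (x y : R) :
  `|Num.min 1 (Num.max 0 x) - Num.min 1 (Num.max 0 y)| <= `|x - y|.
Proof.
have := ler_norm (x - y); have := ler_norm (- (x - y)); rewrite normrN => *.
rewrite ler_norml; have [?|?] := leP 0 x; have [?|?] := leP 0 y;
  rewrite ?(@min_r _ _ 1 0) ?ler01//; try have [?|?] := leP 1 x;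
  try have [?|?] := leP 1 y; lra.
Qed.

Lemma potential_square n q w : 0 < q.2 <= D -> in_sq R q w ->
  `|potential n w - potential n (sq_center R q)| <= weight n q.
Proof.
move=> /andP[q0 qD] wq; rewrite /potential -sumrB /weight mulr_sumr.
apply: le_trans (ler_norm_sum _ _ _) _; apply: ler_sum => k _.
have wm := in_sq_dist_center _ _ _ wq.
rewrite /near_disk.
have [far|_] := ltP (2 ^+ k.+2 * D) (normc (sq_center R q - w0)).
  rewrite mulr0n mul0r mulr0.
  have e2 : 2 ^+ k.+2 * D = 2 * (2 ^+ k.+1 * D) by rewrite [in LHS]exprS mulrA.
  have e1 : D <= 2 ^+ k.+1 * D by rewrite ler_peMl ?exprn_ege1 ?ler1n// ltW.
  rewrite e2 in far.
  have wc := normcB_le _ w (sq_center R q) w0; rewrite (normc_sub _ _ w) in wc.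
  by rewrite !ramp_eq1 ?subrr ?normr0//; lra.
apply: le_trans (min1_max0_lip _ _) _.
have -> (x y c : R) : x / c - 1 - (y / c - 1) = (x - y) / c by ring.
have -> : `|q.2| / D * (true%:R / 2 ^+ k) = q.2 / (2 ^+ k * D).
  by rewrite (gtr0_norm q0) mul1r invfM mulrA mulrAC.
rewrite normrM [X in _ * X]gtr0_norm ?invr_gt0// ler_pM2r ?invr_gt0//.
apply: le_trans (normcB_le_norm _ _ _) _.
by rewrite opprB addrA subrK.
Qed.

Lemma sum_halves_le2 n (b : nat -> bool) : \sum_(k < n) (b k)%:R / 2 ^+ k <= 2 :> R.
Proof.
elim: n b => [|n ih] b; first by rewrite big_ord0.
rewrite big_ord_recl expr0 divr1.
under eq_bigr do rewrite exprSr invfM mulrA.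
rewrite -mulr_suml; have := ih (fun k => b k.+1); rewrite /bump/=.
by case: (b 0%N) => /=; lra.
Qed.

(** By monotonicity [b] is true exactly from some first index j on. The geometric sum is then at
    most 2 / 2^j, and its square at most four times the j-th term on the right. *)
Lemma sqr_sum_halves n (b : nat -> bool) : (forall k, b k -> b k.+1) ->
  (\sum_(k < n) (b k)%:R / 2 ^+ k) ^+ 2 <= 4 * \sum_(k < n) (b k)%:R / 4 ^+ k :> R.
Proof.
elim: n b => [|n ih] b bS; first by rewrite !big_ord0 expr0n mulr0.
have [b0|b0] := boolP (b 0%N).
  have h := sum_halves_le2 n.+1 b.
  apply: (@le_trans _ _ (2 ^+ 2)).
    by rewrite ler_pXn2r ?nnegrE//; apply: sumr_ge0 => k _; rewrite divr_ge0// exprn_ge0.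
  rewrite big_ord_recl b0 expr0 divr1 (_ : true%:R = 1 :> R)//.
  have : 0 <= \sum_(i < n) (b (lift ord0 i))%:R / 4 ^+ (lift ord0 i) :> R.
    by apply: sumr_ge0 => k _; rewrite divr_ge0// exprn_ge0.
  by lra.
rewrite !big_ord_recl (negbTE b0) !mul0r !add0r.
under eq_bigr do rewrite exprSr invfM mulrA.
under [in leRHS]eq_bigr do rewrite exprSr invfM mulrA.
rewrite -!mulr_suml exprMn; have := ih (fun k => b k.+1) (fun k => bS k.+1).
rewrite /bump/=; lra.
Qed.

(** Every scale contributes the same amount: the squares near the k-th disk have total area at most
    (2 * 2^(k+3) D)^2, and 4 / D^2 times this, divided by 4^k, is 2^10. *)
Lemma sum_weight_sqr n (L : seq square) :
  (forall q, q \in L -> 0 < q.2 <= D) ->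
  (forall x y, \sum_(q <- L | in_interior R q x y) 1 <= 1 :> R) ->
  \sum_(q <- L) weight n q ^+ 2 <= 2 ^+ 10 * n%:R.
Proof.
move=> LD count.
have near_diskS q k : near_disk k q -> near_disk k.+1 q.
  move=> /le_trans; apply; rewrite ler_pM2r// ler_eXn2l// ltr1n//.
apply: (@le_trans _ _ (\sum_(q <- L) \sum_(k < n)
    4 / D ^+ 2 * (q.2 ^+ 2 * ((near_disk k q)%:R / 4 ^+ k)))).
  apply: ler_sum => q _; rewrite -mulr_sumr -mulr_sumr /weight exprMn.
  rewrite expr_div_n real_normK ?num_real//.
  have -> (S : R) : 4 / D ^+ 2 * (q.2 ^+ 2 * S) = q.2 ^+ 2 / D ^+ 2 * (4 * S) by ring.
  apply: ler_wpM2l; first by rewrite divr_ge0 ?sqr_ge0.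
  exact: (sqr_sum_halves n (fun k => near_disk k q) (near_diskS q)).
rewrite exchange_big/=.
apply: (@le_trans _ _ (\sum_(k < n) 2 ^+ 10)); last first.
  by rewrite sumr_const card_ord mulr_natr.
apply: ler_sum => k _; rewrite -mulr_sumr.
have -> : \sum_(q <- L) q.2 ^+ 2 * ((near_disk k q)%:R / 4 ^+ k) =
    (\sum_(q <- L | (q \in L) && near_disk k q) q.2 ^+ 2) / 4 ^+ k.
  rewrite -big_seq_cond mulr_suml [RHS]big_mkcond/=; apply: eq_bigr => q _.
  by case: ifP => _; rewrite ?mul1r// mul0r mulr0.
have area : \sum_(q <- L | (q \in L) && near_disk k q) q.2 ^+ 2 <=
    (2 * (2 ^+ k.+3 * D)) ^+ 2.
  apply: (squares_area _ _ _ (complex.Re w0) (complex.Im w0)) => //.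
    exact: ltW.
  move=> q /andP[/LD/andP[q0 qD] nd].
  have e1 : 2 ^+ k.+3 * D = 2 * (2 ^+ k.+2 * D) by rewrite exprS mulrA.
  have e2 : D <= 2 ^+ k.+2 * D by rewrite ler_peMl ?exprn_ege1 ?ler1n// ltW.
  have := le_trans (Re_le_normc _ _) nd; have := le_trans (Im_le_normc _ _) nd.
  rewrite ReB ImB/= => ? ?.
  by split => //; lra.
have D2 : 0 < D ^+ 2 by rewrite exprn_gt0.
have k4 : 0 < 4 ^+ k :> R by rewrite exprn_gt0.
have -> : 2 ^+ 10 = 4 / D ^+ 2 * ((2 * (2 ^+ k.+3 * D)) ^+ 2 / 4 ^+ k) :> R.
  have -> : 4 ^+ k = 2 ^+ k * 2 ^+ k :> R by rewrite -exprMn -natrM.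
  rewrite !exprS; field.
  by rewrite !gt_eqF// exprn_gt0.
by rewrite ler_pM2l ?divr_gt0// ler_pM2r ?invr_gt0.
Qed.

(** Within the largest disk the term of the last scale, with index [n], is already a sufficient
    lower bound for the weight. This converts weighted lengths into Euclidean ones. *)
Lemma side_le_weight n q w : 0 < q.2 <= D -> in_sq R q w ->
  normc (w - w0) <= 2 ^+ n.+1 * D -> q.2 <= 2 ^+ n * D * weight n.+1 q.
Proof.
move=> /andP[q0 qD] wq wD.
have wm := in_sq_dist_center _ _ _ wq.
have nd : near_disk n q.
  have e1 : 2 ^+ n.+2 * D = 2 * (2 ^+ n.+1 * D) by rewrite [in LHS]exprS mulrA.
  have e2 : D <= 2 ^+ n.+1 * D by rewrite ler_peMl ?exprn_ege1 ?ler1n// ltW.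
  rewrite /near_disk; have := normcB_le _ w (sq_center R q) w0.
  by rewrite (normc_sub _ _ w) e1; lra.
rewrite /weight big_ord_recr/= nd gtr0_norm//.
have n2 : 0 < 2 ^+ n :> R by rewrite exprn_gt0.
have -> (S : R) : 2 ^+ n * D * (q.2 / D * (S + 1 / 2 ^+ n)) = q.2 + 2 ^+ n * (q.2 * S).
  by field; rewrite !gt_eqF.
rewrite lerDl; apply: mulr_ge0; first exact: ltW.
apply: mulr_ge0; first exact: ltW.
by apply: sumr_ge0 => k _; rewrite divr_ge0// exprn_ge0.
Qed.

End Potential.

(** * Averaging over lines, oscillation along a line, inscribed polygons *)

Section Lines.
Variable R : realType.
Local Notation C := (plane R).

Lemma good_line (T : Type) (L : seq T) (c e p : T -> R) (a b A : R) :
  a <= b -> (forall q, 0 <= c q) -> (forall q, 0 <= e q) ->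
  \sum_(q <- L) c q * (2 * e q) < A * (b - a) ->
  exists2 x, a <= x <= b & \sum_(q <- L | `|x - p q| <= e q) c q <= A.
Proof.
move=> ab c0 e0; apply: contraPP => /forall2NP H; apply/negP; rewrite -leNgt.
apply: (weighted_cover_le R T L c p e predT) => // x xab.
by have [//|/negP] := H x; rewrite -ltNge => /ltW.
Qed.

(** By the intermediate value theorem every value between [p a] and [p b] is taken, hence lies in
    one of the intervals of radius [cq q] about [pq q]. Covering values instead of times makes it
    unnecessary to order the squares along the curve. *)
Lemma osc_le (T : eqType) (L : seq T) (P : pred T) (p : R -> R) (pq cq : T -> R)
    (a b : R) :
  a <= b -> continuous p -> (forall q, 0 <= cq q) ->
  (forall t, a <= t <= b -> exists2 q, q \in L & P q /\ `|p t - pq q| <= cq q) ->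
  `|p a - p b| <= \sum_(q <- L | P q) 2 * cq q.
Proof.
move=> ab cp c0 cover.
have -> : \sum_(q <- L | P q) 2 * cq q = \sum_(q <- L | P q) 1 * (2 * cq q).
  by apply: eq_bigr => q _; rewrite mul1r.
have -> : `|p a - p b| = 1 * (Num.max (p a) (p b) - Num.min (p a) (p b)).
  by rewrite mul1r; case: (leP (p a) (p b)) => h; [rewrite ler0_norm|rewrite gtr0_norm]; lra.
apply: (weighted_cover_le R T L (fun=> 1) pq cq P) => //.
  by rewrite ge_min le_max !lexx.
move=> v vab.
have [t] : exists2 t, t \in `[a, b] & p t = v.
  by apply: IVT => //; exact: continuous_subspaceT.
rewrite in_itv/= => /cover[q qL [Pq pq_t]] <-.
rewrite (big_rem q)//= Pq pq_t/= lerDl; exact: sumr_ge0.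
Qed.

Lemma sum_near_le3 (N : nat) (b : nat -> bool) :
  (forall i j, b i -> b j -> (i <= j.+1)%N) ->
  \sum_(1 <= j < N) (b j)%:R <= 3 :> R.
Proof.
move=> bP; have [[k bk]|nb] := pselect (exists k, b k); last first.
  rewrite big1 ?ler0n// => j _; case: (boolP (b j)) => // bj.
  by exfalso; apply: nb; exists j.
have one (i : nat) : \sum_(1 <= j < N) (j == i)%:R <= 1 :> R.
  have [iN|iN] := boolP (i \in index_iota 1 N); last first.
    rewrite big_seq big1 ?ler01// => j jN; case: eqP => // ji.
    by rewrite -ji jN in iN.
  rewrite (bigD1_seq i) ?iota_uniq//= eqxx big1 ?addr0// => j /negPf -> //.
apply: (@le_trans _ _ (\sum_(1 <= j < N)
    ((j == k.-1)%:R + (j == k)%:R + (j == k.+1)%:R))).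
  apply: ler_sum => j _; case: (boolP (b j)) => [bj|_]; last by rewrite !addr_ge0.
  have := bP _ _ bj bk; have := bP _ _ bk bj => kj jk.
  have : [|| j == k.-1, j == k | j == k.+1] by lia.
  rewrite -!natrD ler_nat.
  by case: (j == k.-1); case: (j == k); case: (j == k.+1).
rewrite !big_split/=; have := one k.-1; have := one k; have := one k.+1; lra.
Qed.

(** Each chord is bounded by the diameters [2 * cq q] of the squares met on its parameter interval.
    Since the parameters in one square differ by less than 1/N, a square is met on at most three
    intervals, and 6 = 2 * 3. *)
Lemma polygon_le (T : eqType) (L : seq T) (B : pred T) (cq : T -> R)
    (ctr : T -> C) (inn : T -> R -> Prop) (gam : R -> C) (N : nat) :
  (0 < N)%N -> (forall q, 0 <= cq q) -> continuous gam ->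
  (forall t, N%:R^-1 <= t <= 1 - N%:R^-1 ->
     exists2 q, q \in L & B q /\ inn q t) ->
  (forall q t, q \in L -> N%:R^-1 <= t <= 1 - N%:R^-1 -> inn q t ->
     normc (gam t - ctr q) <= cq q) ->
  (forall q t u, q \in L -> N%:R^-1 <= t <= 1 - N%:R^-1 ->
     N%:R^-1 <= u <= 1 - N%:R^-1 -> inn q t -> inn q u -> t - u < N%:R^-1) ->
  \sum_(1 <= j < N.-1) normc (gam (j%:R / N%:R) - gam (j.+1%:R / N%:R)) <=
    6 * \sum_(q <- L | B q) cq q.
Proof.
move=> N0 c0 cg cover near sep.
have NR : 0 < N%:R :> R by rewrite ltr0n.
pose meets j q := `[< exists t, [/\ N%:R^-1 <= t <= 1 - N%:R^-1,
   j%:R / N%:R <= t <= j.+1%:R / N%:R & inn q t] >].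
apply: (@le_trans _ _ (\sum_(1 <= j < N.-1) \sum_(q <- L | B q)
   (meets j q)%:R * (2 * ((q \in L)%:R * cq q)))).
  rewrite big_nat [leRHS]big_nat; apply: ler_sum => j /andP[j1 jN].
  have jj : j%:R / N%:R <= j.+1%:R / N%:R :> R.
    by rewrite ler_pM2r ?invr_gt0// ler_nat.
  have jlo : N%:R^-1 <= j%:R / N%:R :> R by rewrite ler_peMl ?invr_ge0 ?ler0n// ler1n.
  have jhi : j.+1%:R / N%:R <= 1 - N%:R^-1 :> R.
    rewrite ler_pdivrMr// mulrBl mul1r mulVf ?gt_eqF// lerBrDr -(natrD _ _ 1) ler_nat.
    by lia.
  rewrite normc_sub.
  (* The distance to the initial node turns the chord into the oscillation of a real function, to
     which [osc_le] applies. *)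
  pose p t := normc (gam t - gam (j%:R / N%:R)).
  have -> : normc (gam (j.+1%:R / N%:R) - gam (j%:R / N%:R)) =
      `|p (j%:R / N%:R) - p (j.+1%:R / N%:R)|.
    by rewrite /p subrr normc0 sub0r normrN ger0_norm// normc_ge0.
  have cp : continuous p.
    exact: (continuous_fun_comp _ _ _ _ _ cg (continuous_normcB _ _)).
  apply: le_trans (osc_le T L (fun q => B q && meets j q) p
    (fun q => normc (ctr q - gam (j%:R / N%:R))) (fun q => (q \in L)%:R * cq q)
    _ _ jj cp _ _) _.
  - by move=> q; rewrite mulr_ge0.
  - move=> t /andP[tj jt].
    have tI : N%:R^-1 <= t <= 1 - N%:R^-1 by apply/andP; split; lra.
    have [q qL [Bq qt]] := cover t tI.
    exists q => //; split.
      by rewrite Bq; apply/asboolP; exists t; split => //; apply/andP.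
    rewrite qL mul1r; apply: le_trans (near _ _ qL tI qt).
    apply: le_trans (normcB_le_norm _ _ _) _.
    by rewrite opprB addrA subrK.
  - rewrite big_mkcondr; apply: ler_sum => q _.
    by case: ifP => _; rewrite ?mul1r// mul0r.
rewrite exchange_big/= mulr_sumr big_seq_cond [leRHS]big_seq_cond.
apply: ler_sum => q /andP[qL _]; rewrite -mulr_suml qL mul1r.
have -> : 6 * cq q = 3 * (2 * cq q) by lra.
apply: ler_wpM2r; first by rewrite mulr_ge0.
apply: sum_near_le3 => i j /asboolP[t [tI /andP[it ti] qt]] /asboolP[u [uI /andP[ju uj] qu]].
have tu := sep _ _ _ qL tI uI qt qu.
have : i%:R / N%:R < j.+2%:R / N%:R :> R.
  have -> : j.+2%:R / N%:R = j.+1%:R / N%:R + N%:R^-1 :> R by rewrite -[j.+2%:R]natr1 mulrDl mul1r.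
  by lra.
by rewrite ltr_pM2r ?invr_gt0// ltr_nat ltnS.
Qed.

End Lines.

(** * A segment leaving the domain crosses every inner rectangle about its starting image *)

Section Segment.
Variable R : realType.
Local Notation C := (plane R).
Local Notation square := (R * R * R)%type.
Local Notation Re := (@complex.Re R).
Local Notation Im := (@complex.Im R).
Variables (Q : set C) (phi G : C -> C) (M : R).
Hypothesis chart : conformal_chart R Q phi G M.

Let M_gt0 : 0 < M := chart_gt0 _ _ _ _ _ chart.

Lemma chart_continuous c : Q c ->
  forall e : R, 0 < e -> exists2 d : R, 0 < d &
    forall w, normc (w - c) < d -> normc (phi w - phi c) < e.
Proof.
move=> Qc e e0; have [l lP] := chart_diff _ _ _ _ _ chart _ Qc.
have [d d0 dP] := lP 1 ltr01.
have l1 : 0 < normc l + 1 by rewrite ltr_wpDl// normc_ge0.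
exists (Num.min d (e / (normc l + 1))); first by rewrite lt_min d0 divr_gt0.
move=> w; rewrite lt_min ltr_pdivlMr// => /andP[/dP wd we].
rewrite -[phi w - phi c](subrK (l * (w - c))).
apply: le_lt_trans (normcD_le _ _ _) _; rewrite normcM.
by have := normc_ge0 _ (w - c); lra.
Qed.

Lemma continuous_at_minr (T : topologicalType) (x y : T -> R) (t : T) :
  {for t, continuous x} -> {for t, continuous y} ->
  {for t, continuous (fun t => Num.min (x t) (y t))}.
Proof.
move=> cx cy; rewrite /prop_for/continuous_at; under eq_fun do rewrite minr_absE.
rewrite minr_absE; apply: cvgM; last exact: cvg_cst.
apply: cvgB; first by apply: cvgD; [exact: cx|exact: cy].
by apply: cvg_norm; apply: cvgB; [exact: cx|exact: cy].
Qed.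

(* The segment from [w0] to a point outside [Q] leaves [Q], so its image leaves
   every compact subrectangle of the chart. *)
Lemma segment_crosses_rectangle (w0 ws : C) (x1 x2 y1 y2 : R) :
  Q w0 -> ~ Q ws ->
  0 < x1 -> x2 < M -> 0 < y1 -> y2 < 1 ->
  x1 < Re (phi w0) < x2 -> y1 < Im (phi w0) < y2 ->
  exists w, [/\ Q w, normc (w - w0) <= normc (ws - w0),
    x1 <= Re (phi w) <= x2, y1 <= Im (phi w) <= y2 &
    [\/ Re (phi w) = x1, Re (phi w) = x2, Im (phi w) = y1 | Im (phi w) = y2]].
Proof.
move=> Qw0 nQws x10 x2M y10 y21 /andP[wx1 wx2] /andP[wy1 wy2].
pose sg (t : R) : C := (Re w0 + t * Re (ws - w0)) +i* (Im w0 + t * Im (ws - w0)).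
have sg_cont : continuous sg.
  apply: continuous_Complex => t; apply: cvgD; try exact: cvg_cst;
    by apply: cvgM; [exact: cvg_id|exact: cvg_cst].
have sg0 : sg 0 = w0 by rewrite /sg !mul0r !addr0; case: (w0).
have sg1 : sg 1 = ws.
  by rewrite /sg !mul1r ReB ImB !(addrC _ (_ - _)) !subrK; case: (ws).
have sg_dist t : 0 <= t <= 1 -> normc (sg t - w0) <= normc (ws - w0).
  move=> /andP[t0 t1].
  have -> : sg t - w0 = t%:C * (ws - w0).
    rewrite /sg; case: (w0) => a b; case: (ws) => a' b'.
    by apply/eqP; rewrite eq_complex/=; apply/andP; split; apply/eqP; ring.
  rewrite normcM /= expr0n addr0 sqrtr_sqr ger0_norm//.
  by rewrite ler_piMl// normc_ge0.
have sg_near t : forall e : R, 0 < e -> exists2 d : R, 0 < d &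
    forall u, `|u - t| < d -> normc (sg u - sg t) < e.
  move=> e e0; have : nbhs (sg t) [set z | normc (z - sg t) < e].
    by apply/nbhs_normcP; exists e.
  move=> /sg_cont /nbhs_ballP[d /= d0 h]; exists d => // u ud.
  by apply: (h u); rewrite /ball/= distrC.
pose S := [set t : R | 0 <= t <= 1 /\ forall u, 0 <= u <= t -> Q (sg u)].
have S0 : S 0.
  split; first by rewrite lexx ler01.
  move=> u u0; have -> : u = 0 by apply/le_anti; rewrite andbC.
  by rewrite sg0.
have hS : has_sup S.
  split; first by exists 0.
  by exists 1; move=> t [/andP[_ t1] _].
have s01 : 0 <= sup S <= 1.
  apply/andP; split; first by apply: ub_le_sup => //; exact: hS.2.
  by apply: ge_sup => [|t [/andP[_ t1] _]]; first exact: hS.1.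
have adh e : 0 < e -> exists2 t, S t & sup S - e < t.
  by move=> e0; exact: sup_adherent.
have nQ : ~ Q (sg (sup S)).
  move=> Qs; have [d d0 dP] := chart_open _ _ _ _ _ chart _ Qs.
  have [d' d'0 d'P] := sg_near (sup S) d d0.
  have Sm : S (Num.min 1 (sup S + d' / 2)).
    split.
      rewrite ge_min lexx andbT le_min ler01/= addr_ge0 ?divr_ge0//; last exact: ltW.
      by case/andP: s01.
    move=> u /andP[u0]; rewrite le_min => /andP[u1 us].
    have [us'|us'] := ltP u (sup S).
      have [t [_ St] tu] := adh (sup S - u) (eqbRL (subr_gt0 _ _) us').
      by apply: St; rewrite u0/=; lra.
    by apply/dP/d'P; rewrite ger0_norm; lra.
  have := ub_le_sup hS.2 Sm; rewrite ge_min => /orP[s1|]; last by lra.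
  have s1' : sup S = 1 by lra.
  by apply: nQws; rewrite -sg1 -s1'.
pose tau := Num.min (Num.min x1 (M - x2)) (Num.min y1 (1 - y2)).
have tau0 : 0 < tau by rewrite !lt_min x10 y10 !subr_gt0 x2M y21.
have [d d0 dP] := chart_out _ _ _ _ _ chart _ nQ _ tau0.
have [d' d'0 d'P] := sg_near (sup S) d d0.
have [t St st] := adh d' d'0.
have [/andP[t0 t1] tQ] := St.
have ts : t <= sup S by apply: ub_le_sup => //; exact: hS.2.
have Qt : Q (sg t) by apply: tQ; rewrite t0 lexx.
have out : ~~ inner_rect R M tau (phi (sg t)).
  by apply: dP => //; apply: d'P; rewrite ler0_norm; lra.
(* The least signed distance to the four sides is positive at the start and at most 0 once the image
   is outside [inner_rect M tau]. At a zero of [k] the image lies in the closed rectangle and on one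
   of its sides. *)
pose k u := Num.min
  (Num.min (Re (phi (sg u)) - x1) (x2 - Re (phi (sg u))))
  (Num.min (Im (phi (sg u)) - y1) (y2 - Im (phi (sg u)))).
have phi_cont u : 0 <= u <= t -> {for u, continuous (fun u => phi (sg u))}.
  move=> /tQ Qu B /nbhs_normcP[e e0 eB].
  have [c c0 cP] := chart_continuous _ Qu _ e0.
  have [c' c'0 c'P] := sg_near u _ c0.
  apply/nbhs_ballP; exists c' => // v; rewrite /ball/= distrC => uv.
  exact/eB/cP/c'P.
have k_cont : {within `[0, t], continuous k}.
  apply: continuous_in_subspaceT => u; rewrite inE/= in_itv/= => ut.
  have cR : {for u, continuous (fun u => Re (phi (sg u)))}.
    exact: (continuous_comp (phi_cont _ ut) (continuous_Re _ _)).
  have cI : {for u, continuous (fun u => Im (phi (sg u)))}.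
    exact: (continuous_comp (phi_cont _ ut) (continuous_Im _ _)).
  have cB (f : R -> R) a : {for u, continuous f} -> {for u, continuous (fun u => f u - a)}.
    by move=> cf; apply: cvgB; [exact: cf|exact: cvg_cst].
  have cB' (f : R -> R) a : {for u, continuous f} -> {for u, continuous (fun u => a - f u)}.
    by move=> cf; apply: cvgB; [exact: cvg_cst|exact: cf].
  exact: (continuous_at_minr _ _ _ _
    (continuous_at_minr _ _ _ _ (cB _ _ cR) (cB' _ _ cR))
    (continuous_at_minr _ _ _ _ (cB _ _ cI) (cB' _ _ cI))).
have k0 : 0 < k 0 by rewrite /k sg0 !lt_min !subr_gt0 wx1 wx2 wy1 wy2.
have kt : k t <= 0.
  rewrite leNgt; apply/negP; rewrite /k !lt_min !subr_gt0.
  move=> /andP[/andP[h1 h2] /andP[h3 h4]]; move/negP: out; apply.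
  have /andP[l1 l2] : (tau <= x1) && (tau <= M - x2) by rewrite -le_min ge_min lexx.
  have /andP[l3 l4] : (tau <= y1) && (tau <= 1 - y2) by rewrite -le_min ge_min lexx orbT.
  clear - l1 l2 l3 l4 h1 h2 h3 h4.
  by rewrite /inner_rect; apply/andP; split; apply/andP; split; lra.
have [u] : exists2 u, u \in `[0, t] & k u = 0.
  by apply: IVT => //; rewrite ge_min kt orbT le_max (ltW k0).
rewrite in_itv/= => ut ku.
exists (sg u); split; first exact: tQ.
- by apply: sg_dist; move: ut => /andP[? ?]; apply/andP; split; lra.
- have : 0 <= k u by rewrite ku.
  by rewrite /k !le_min !subr_ge0 => /andP[/andP[? ?] _]; apply/andP.
- have : 0 <= k u by rewrite ku.
  by rewrite /k !le_min !subr_ge0 => /andP[_ /andP[? ?]]; apply/andP.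
- have : k u <= 0 by rewrite ku.
  have : 0 <= k u by rewrite ku.
  rewrite /k !le_min !ge_min !subr_ge0 !subr_le0 => /andP[/andP[? ?] /andP[? ?]].
  move=> /orP[/orP[?|?]|/orP[?|?]];
    [constructor 1|constructor 2|constructor 3|constructor 4]; lra.
Qed.

End Segment.

(** * The length-area argument at a fixed fineness *)

Section Stage.
Variable R : realType.
Local Notation C := (plane R).
Local Notation square := (R * R * R)%type.
Local Notation Re := (@complex.Re R).
Local Notation Im := (@complex.Im R).
Variables (Q : set C) (phi G : C -> C) (M : R).
Hypothesis chart : conformal_chart R Q phi G M.

Let M_gt0 : 0 < M := chart_gt0 _ _ _ _ _ chart.

Lemma norm_chain (a b r s : R) : `|a - b| <= r -> `|b| <= s -> `|a| <= r + s.
Proof.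
by move=> ab bs; rewrite -(subrK b a) (le_trans (ler_normD _ _))// lerD.
Qed.

Variables (D B : R) (ws : C) (m : nat).
Let w0 := G ((M / 2) +i* (1 / 2)).
Hypotheses (B_gt0 : 0 < B) (BM : 2 ^+ 10 + 65 * M < B * (M / 4))
  (B1 : 2 ^+ 10 + 65 * M < B * (1 / 4)).
Hypotheses (D_gt0 : 0 < D) (nQws : ~ Q ws) (wsD : normc (ws - w0) <= D).
Hypothesis m_large : 6 * B < m%:R.
Let n := (m * m)%N.
Let h := potential R w0 D n.
Let A := m%:R * B.

(** The squares and lines depend on [N], the bound does not. The point [w] where the segment meets
    one of four light lines has potential 0. At most three lines lead from it to any point of the
    two lines kept, so the potential there is at most 6A, below its far value n, and these lines
    stay within 2^n D of [w0]. *)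
Lemma stage N : (8 <= N)%N ->
  (exists2 x, M / 8 <= x <= 3 / 8 * M &
     \sum_(1 <= j < N.-1) normc (G (x +i* (j%:R / N%:R)) - G (x +i* (j.+1%:R / N%:R)))
       <= 6 * (2 ^+ n * D * A)) /\
  (exists2 y, 1 / 8 <= y <= 3 / 8 &
     \sum_(1 <= j < N.-1) normc (G ((M * (j%:R / N%:R)) +i* y)
                                 - G ((M * (j.+1%:R / N%:R)) +i* y))
       <= 6 * (2 ^+ n * D * A)).
Proof.
move=> N8.
have NR : 0 < N%:R :> R by rewrite ltr0n (leq_trans _ N8).
have N8' : N%:R^-1 <= 1 / 8 :> R.
  by rewrite div1r lef_pV2 ?posrE// ler_nat.
have Ninv : 0 < N%:R^-1 :> R by rewrite invr_gt0.
(* The shorter side of the rectangle. Two image points of one square are at most mu1/(2N) apart,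
   which is less than the node spacing 1/N on vertical lines and M/N on horizontal ones. *)
pose mu1 := Num.min 1 M.
have mu10 : 0 < mu1 by rewrite lt_min ltr01.
have [mu1_1 mu1_M] : mu1 <= 1 /\ mu1 <= M by rewrite !ge_min !lexx orbT.
pose nu := mu1 * N%:R^-1 / 4.
have nu0 : 0 < nu by rewrite divr_gt0// mulr_gt0.
have tau0 : 0 < mu1 * N%:R^-1 by rewrite mulr_gt0.
have tN : mu1 * N%:R^-1 <= N%:R^-1 by rewrite ler_piMl// ltW.
have tM : mu1 * N%:R^-1 <= M * N%:R^-1 by rewrite ler_pM2r.
have MN : M * N%:R^-1 <= M / 8 by rewrite ler_pM2l//; move: N8'; rewrite div1r.
pose I (t : R) : bool := N%:R^-1 <= t <= 1 - N%:R^-1.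
have G_inner z : inner_rect R M (mu1 * N%:R^-1) z -> Q (G z) /\ phi (G z) = z.
  move=> zin; apply: (chart_inv _ _ _ _ _ chart).
  exact: inner_rect_open zin.
have innerx x t : M / 8 <= x <= 7 / 8 * M -> I t ->
    inner_rect R M (mu1 * N%:R^-1) (x +i* t).
  move=> /andP[? ?] /andP[? ?].
  by rewrite /inner_rect/=; apply/andP; split; apply/andP; split; lra.
have innery (y t : R) : 1 / 8 <= y <= 7 / 8 -> I t ->
    inner_rect R M (mu1 * N%:R^-1) ((M * t) +i* y).
  move=> /andP[? ?] /andP[h1 h2].
  have : M * N%:R^-1 <= M * t by rewrite ler_pM2l.
  have : M * t <= M * (1 - N%:R^-1) by rewrite ler_pM2l.
  by rewrite /inner_rect/= => ? ?; apply/andP; split; apply/andP; split; lra.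
have inIy (y : R) : 1 / 8 <= y <= 7 / 8 -> I y.
  by move=> /andP[? ?]; apply/andP; split; lra.
have inIx x : M / 8 <= x <= 7 / 8 * M -> exists2 t, I t & x = M * t.
  move=> /andP[xa xb]; exists (x / M); last by rewrite mulrCA divff ?mulr1// gt_eqF.
  apply/inIy; rewrite ler_pdivlMr// ler_pdivrMr//; apply/andP; split; lra.
have m0 : 0 < m%:R :> R by apply: lt_trans m_large; rewrite mulr_gt0.
have lowx x : M / 8 <= x <= 3 / 8 * M -> [/\ 0 < x, x < M / 2 & M / 8 <= x <= 7 / 8 * M].
  by move=> /andP[? ?]; split; last (apply/andP; split); lra.
have highx x : 5 / 8 * M <= x <= 7 / 8 * M ->
    [/\ M / 2 < x, x < M & M / 8 <= x <= 7 / 8 * M].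
  by move=> /andP[? ?]; split; last (apply/andP; split); lra.
have lowy (y : R) : 1 / 8 <= y <= 3 / 8 -> [/\ 0 < y, y < 1 / 2 & 1 / 8 <= y <= 7 / 8].
  by move=> /andP[? ?]; split; last (apply/andP; split); lra.
have highy (y : R) : 5 / 8 <= y <= 7 / 8 -> [/\ 1 / 2 < y, y < 1 & 1 / 8 <= y <= 7 / 8].
  by move=> /andP[? ?]; split; last (apply/andP; split); lra.
have strips : [/\ 3 / 8 * M - M / 8 = M / 4, 7 / 8 * M - 5 / 8 * M = M / 4,
    3 / 8 - 1 / 8 = 1 / 4 :> R & 7 / 8 - 5 / 8 = 1 / 4 :> R].
  by split; field.
have z0in : open_rect R M ((M / 2) +i* (1 / 2)).
  by rewrite /open_rect/=; apply/andP; split; apply/andP; split; lra.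
have close (d : R) : `|d| <= mu1 * N%:R^-1 / 2 -> d < N%:R^-1.
  by have := ler_norm d; lra.
have closeM (d : R) : `|d| <= mu1 * N%:R^-1 / 2 -> d < M * N%:R^-1.
  by have := ler_norm d; lra.
have A0 : 0 <= A by rewrite /A mulr_ge0// ltW.
have A2 : 2 * A + 0 <= 2 * A + (2 * A + 0) by lra.
have A6 : 2 * A + (2 * A + (2 * A + 0)) = 6 * A by ring.
(* Here n = m^2 beats three oscillations of 2 A = 2 m B, because m > 6 B. *)
have nA : 6 * A < n%:R.
  rewrite /n natrM /A; have -> : 6 * (m%:R * B) = m%:R * (6 * B) by ring.
  by rewrite ltr_pM2l.
have nu2 : nu + nu = mu1 * N%:R^-1 / 2 by rewrite /nu; field; rewrite gt_eqF.
have [L [e [LP e0 eP Lcov [Lcount Lsum]]]] :=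
  stage_cover _ _ _ _ _ chart _ _ _ tau0 nu0 D_gt0.
pose wt := weight R w0 D n.
have wt0 q : 0 <= wt q by exact: weight_ge0.
have LD q : q \in L -> 0 < q.2 <= D by move=> /LP[].
have sum_we : \sum_(q <- L) wt q * (2 * e q) <= m%:R * (2 ^+ 10 + 65 * M).
  (* AM-GM instead of Cauchy-Schwarz: [2 w e <= w^2 / m + m e^2] *)
  apply: (@le_trans _ _ (\sum_(q <- L) (m%:R^-1 * wt q ^+ 2 + m%:R * e q ^+ 2))).
    apply: ler_sum => q _.
    have -> : m%:R^-1 * wt q ^+ 2 + m%:R * e q ^+ 2 =
        wt q * (2 * e q) + m%:R^-1 * (wt q - m%:R * e q) ^+ 2.
      by field; rewrite gt_eqF.
    by rewrite lerDl mulr_ge0 ?sqr_ge0// invr_ge0 ltW.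
  rewrite big_split/= -!mulr_sumr.
  have W := sum_weight_sqr _ w0 _ D_gt0 n L LD Lcount.
  have {}W : m%:R^-1 * \sum_(q <- L) wt q ^+ 2 <= m%:R * 2 ^+ 10.
    rewrite mulrC ler_pdivrMr//; apply: le_trans W _.
    by rewrite /n natrM; lra.
  have : m%:R * \sum_(q <- L) e q ^+ 2 <= m%:R * (65 * M) by rewrite ler_pM2l.
  by lra.
have pickx (a b : R) : b - a = M / 4 -> exists2 x, a <= x <= b &
    \sum_(q <- L | `|x - Re (phi (sq_center R q))| <= e q) wt q <= A.
  move=> ab; apply: good_line => //; first by rewrite -subr_ge0 ab divr_ge0// ltW.
  apply: le_lt_trans sum_we _; rewrite ab.
  have -> (r : R) : A * r = m%:R * (B * r) by rewrite mulrA.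
  by rewrite ltr_pM2l.
have picky (a b : R) : b - a = 1 / 4 -> exists2 y, a <= y <= b &
    \sum_(q <- L | `|y - Im (phi (sq_center R q))| <= e q) wt q <= A.
  move=> ab; apply: good_line => //; first by rewrite -subr_ge0 ab divr_ge0// ltW.
  apply: le_lt_trans sum_we _; rewrite ab.
  have -> (r : R) : A * r = m%:R * (B * r) by rewrite mulrA.
  by rewrite ltr_pM2l.
have [st1 st2 st3 st4] := strips.
have [x1 x1I x1S] := pickx _ _ st1.
have [x2 x2I x2S] := pickx _ _ st2.
have [y1 y1I y1S] := picky _ _ st3.
have [y2 y2I y2S] := picky _ _ st4.
have contx x : continuous (fun t => G (x +i* t)).
  apply: (continuous_fun_comp _ _ _ (fun t : R => (x +i* t) : C)).
    by apply: continuous_Complex => t; [exact: cvg_cst|exact: cvg_id].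
  exact: chart_cont _ _ _ _ _ chart.
have conty y : continuous (fun t => G ((M * t) +i* y)).
  apply: (continuous_fun_comp _ _ _ (fun t : R => ((M * t) +i* y) : C)).
    apply: continuous_Complex => t; last exact: cvg_cst.
    by apply: cvgM; [exact: cvg_cst|exact: cvg_id].
  exact: chart_cont _ _ _ _ _ chart.
have osc_line (P : pred square) (gam : R -> C) : continuous gam ->
    (forall t, I t -> exists2 q, q \in L & P q /\ in_sq R q (gam t)) ->
    \sum_(q <- L | P q) wt q <= A ->
    forall t u, I t -> I u -> `|h (gam t) - h (gam u)| <= 2 * A.
  move=> cg cov SA t u.
  wlog tu : t u / t <= u.
    move=> H tI uI; have [tu|/ltW ut] := leP t u; first exact: H.
    by rewrite distrC; exact: H.
  move=> /andP[It _] /andP[_ Iu].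
  apply: (@le_trans _ _ (\sum_(q <- L | P q) 2 * wt q)); last first.
    by rewrite -mulr_sumr ler_pM2l.
  apply: (osc_le R _ L P (h \o gam) (fun q => h (sq_center R q)) wt t u tu) => //.
    exact: (continuous_fun_comp _ _ _ _ _ cg (continuous_potential _ w0 D n)).
  move=> v /andP[tv vu]; have [|q qL [Pq qv]] := cov v.
    by rewrite /I (le_trans It tv) (le_trans vu Iu).
  by exists q => //; split => //; apply: potential_square => //; exact: LD.
have covx x t : M / 8 <= x <= 7 / 8 * M -> I t -> exists2 q, q \in L &
    (`|x - Re (phi (sq_center R q))| <= e q) /\ in_sq R q (G (x +i* t)).
  move=> xI tI; have [q qL qG] := Lcov _ (innerx x t xI tI).
  exists q => //; split => //.
  have [_ /(le_trans (Re_le_normc _ _))] := eP q _ qL qG.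
  by have [_ ->] := G_inner _ (innerx x t xI tI); rewrite ReB.
have covy y t : 1 / 8 <= y <= 7 / 8 -> I t -> exists2 q, q \in L &
    (`|y - Im (phi (sq_center R q))| <= e q) /\ in_sq R q (G ((M * t) +i* y)).
  move=> yI tI; have [q qL qG] := Lcov _ (innery y t yI tI).
  exists q => //; split => //.
  have [_ /(le_trans (Im_le_normc _ _))] := eP q _ qL qG.
  by have [_ ->] := G_inner _ (innery y t yI tI); rewrite ImB.
have oscx x : M / 8 <= x <= 7 / 8 * M ->
    \sum_(q <- L | `|x - Re (phi (sq_center R q))| <= e q) wt q <= A ->
    forall t u, I t -> I u -> `|h (G (x +i* t)) - h (G (x +i* u))| <= 2 * A.
  move=> xI; apply: (osc_line _ (fun t => G (x +i* t))) => // t.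
  exact: covx.
have oscy y : 1 / 8 <= y <= 7 / 8 ->
    \sum_(q <- L | `|y - Im (phi (sq_center R q))| <= e q) wt q <= A ->
    forall t u, I t -> I u -> `|h (G ((M * t) +i* y)) - h (G ((M * u) +i* y))| <= 2 * A.
  move=> yI; apply: (osc_line _ (fun t => G ((M * t) +i* y))) => // t.
  exact: covy.
have [x1_gt0 x1M x1J] := lowx _ x1I; have [x2M x2_lt x2J] := highx _ x2I.
have [y1_gt0 y11 y1J] := lowy _ y1I; have [y21 y2_lt y2J] := highy _ y2I.
have [s1 s1I x1E] := inIx _ x1J; have [s2 s2I x2E] := inIx _ x2J.
have [Qw0 phiw0] := chart_inv _ _ _ _ _ chart _ z0in.
have [w [Qw wD /andP[wx1 wx2] /andP[wy1 wy2] wcase]] :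
    exists w, [/\ Q w, normc (w - w0) <= normc (ws - w0),
      x1 <= Re (phi w) <= x2, y1 <= Im (phi w) <= y2 &
      [\/ Re (phi w) = x1, Re (phi w) = x2, Im (phi w) = y1 | Im (phi w) = y2]].
  apply: (segment_crosses_rectangle _ _ _ _ _ chart) => //; rewrite phiw0/=.
    by rewrite x1M x2M.
  by rewrite y11 y21.
have hw : `|h w| <= 0.
  by rewrite normr_le0; apply/eqP/potential_near => //; exact: le_trans wD wsD.
have wE : w = G (Re (phi w) +i* Im (phi w)).
  by have [_ {1}<-] := chart_dom _ _ _ _ _ chart _ Qw; case: (phi w).
have [s sI sE] : exists2 s, I s & Re (phi w) = M * s.
  case/andP: x1J => x1a _; case/andP: x2J => _ x2b.
  by apply: inIx; rewrite (le_trans x1a wx1) (le_trans wx2 x2b).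
have vI : I (Im (phi w)).
  case/andP: y1J => y1a _; case/andP: y2J => _ y2b.
  by apply: inIy; rewrite (le_trans y1a wy1) (le_trans wy2 y2b).
have X1 := oscx _ x1J x1S; have X2 := oscx _ x2J x2S.
have Y1 := oscy _ y1J y1S; have Y2 := oscy _ y2J y2S.
have Iy1 := inIy _ y1J; have Iy2 := inIy _ y2J.
(* The corner belongs to both lines that are kept. It is reached from [w] along one line if [w] lies
   on [x1] or [y1], and along two if [w] lies on [x2] or [y2]. *)
have hc : `|h (G (x1 +i* y1))| <= 2 * A + (2 * A + 0).
  case: wcase => E; rewrite E in wE.
  - by apply: le_trans A2; have := X1 _ _ Iy1 vI; rewrite -wE => /norm_chain; exact.
  - have /norm_chain/(_ hw) hx2 : `|h (G (x2 +i* y1)) - h w| <= 2 * A.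
      by have := X2 _ _ Iy1 vI; rewrite -wE.
    rewrite x2E in hx2.
    by have := Y1 _ _ s1I s2I; rewrite -x1E => /norm_chain; exact.
  - by apply: le_trans A2; have := Y1 _ _ s1I sI; rewrite -sE -x1E -wE => /norm_chain; exact.
  - have /norm_chain/(_ hw) hy2 : `|h (G (x1 +i* y2)) - h w| <= 2 * A.
      by have := Y2 _ _ s1I sI; rewrite -sE -wE -x1E.
    by have := X1 _ _ Iy1 Iy2 => /norm_chain; exact.
have hx1 t : I t -> `|h (G (x1 +i* t))| <= 6 * A.
  by move=> tI; rewrite -A6; exact: norm_chain (X1 _ _ tI Iy1) hc.
have hy1 t : I t -> `|h (G ((M * t) +i* y1))| <= 6 * A.
  move=> tI; rewrite -A6; rewrite x1E in hc.
  exact: norm_chain (Y1 _ _ tI s1I) hc.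
have inside v : `|h v| <= 6 * A -> normc (v - w0) <= 2 ^+ n * D.
  move=> hv; rewrite leNgt; apply/negP => /ltW /(potential_far _ _ _ D_gt0) E.
  by move: hv; rewrite /h E ger0_norm ?ler0n// leNgt nA.
(* The last of the [n] scales has index n - 1, which is where [side_le_weight] is applied. *)
have [n' nE] : exists n', n = n'.+1.
  by exists n.-1; rewrite prednK// muln_gt0 -(ltr0n R) m0.
have side_bound q v : q \in L -> in_sq R q v -> `|h v| <= 6 * A ->
    normc (v - sq_center R q) <= 2 ^+ n * D * wt q.
  move=> qL qv hv; apply: le_trans (in_sq_dist_center _ _ _ qv) _.
  have := side_le_weight _ w0 _ D_gt0 n' q v (LD _ qL) qv.
  rewrite -nE => /(_ (inside _ hv)) /le_trans; apply.
  rewrite ler_wpM2r// ler_pM2r// nE exprS ler_peMl ?exprn_ge0//.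
  by rewrite ler1n.
have nD0 : 0 <= 2 ^+ n * D by rewrite mulr_ge0 ?exprn_ge0// ltW.
have sep z z' q : q \in L -> inner_rect R M (mu1 * N%:R^-1) z ->
    inner_rect R M (mu1 * N%:R^-1) z' -> in_sq R q (G z) -> in_sq R q (G z') ->
    normc (z - z') <= mu1 * N%:R^-1 / 2.
  move=> qL zI z'I zq z'q.
  have [_] := eP q _ qL zq; have [_] := eP q _ qL z'q.
  have [_ ->] := G_inner _ zI; have [_ ->] := G_inner _ z'I.
  move=> ze z'e; apply: le_trans (normcB_le _ (phi (sq_center R q)) z z') _.
  have [_ enu] := LP _ qL; rewrite -nu2 (normc_sub _ (phi _) z').
  by apply: lerD; [apply: le_trans z'e enu|apply: le_trans ze enu].
split.
- exists x1 => //.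
  apply: le_trans (polygon_le R _ L (fun q => `|x1 - Re (phi (sq_center R q))| <= e q)
    (fun q => 2 ^+ n * D * wt q) (sq_center R) (fun q t => in_sq R q (G (x1 +i* t)))
    (fun t => G (x1 +i* t)) N _ _ _ _ _ _) _ => //.
  + by rewrite (leq_trans _ N8).
  + by move=> q; rewrite mulr_ge0.
  + by move=> t tI; exact: covx.
  + by move=> q t qL tI qt; apply: side_bound => //; exact: hx1.
  + move=> q t u qL tI uI qt qu.
    have := sep _ _ q qL (innerx _ _ x1J tI) (innerx _ _ x1J uI) qt qu.
    by move=> /(le_trans (Im_le_normc _ _)); rewrite ImB/= => /close.
  + by rewrite -mulr_sumr ler_pM2l// ler_wpM2l.
- exists y1 => //.
  apply: le_trans (polygon_le R _ L (fun q => `|y1 - Im (phi (sq_center R q))| <= e q)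
    (fun q => 2 ^+ n * D * wt q) (sq_center R) (fun q t => in_sq R q (G ((M * t) +i* y1)))
    (fun t => G ((M * t) +i* y1)) N _ _ _ _ _ _) _ => //.
  + by rewrite (leq_trans _ N8).
  + by move=> q; rewrite mulr_ge0.
  + by move=> t tI; exact: covy.
  + by move=> q t qL tI qt; apply: side_bound => //; exact: hy1.
  + move=> q t u qL tI uI qt qu.
    have := sep _ _ q qL (innery _ _ y1J tI) (innery _ _ y1J uI) qt qu.
    move=> /(le_trans (Re_le_normc _ _)); rewrite ReB/= => /closeM.
    by rewrite -mulrBr ltr_pM2l.
  + by rewrite -mulr_sumr ler_pM2l// ler_wpM2l.
Qed.

End Stage.

(** * Dyadic polygon lengths, limits of lines, arc length *)

Section ArcLength.
Variable R : realType.
Local Notation C := (plane R).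

Definition step (g : R -> C) (N i : nat) : R :=
  normc (g (i%:R / N%:R) - g (i.+1%:R / N%:R)).

(* The end points 0 and 1 are left out: the subdivision points stay inside. *)
Definition dyadic_length (g : R -> C) (k : nat) : R :=
  \sum_(1 <= j < (2 ^ k).-1) step g (2 ^ k) j.

Lemma step_ge0 g N i : 0 <= step g N i. Proof. exact: normc_ge0. Qed.

Lemma sum_step_widen g N a b c d : (a <= b)%N -> (b <= c)%N -> (c <= d)%N ->
  \sum_(b <= i < c) step g N i <= \sum_(a <= i < d) step g N i.
Proof.
move=> ab bc cd.
apply: (@le_trans _ _ (\sum_(b <= i < d) step g N i)).
  rewrite [leRHS](big_cat_nat (n := c))//= lerDl.
  by apply: sumr_ge0 => i _; exact: step_ge0.
rewrite [leRHS](big_cat_nat (n := b)) ?(leq_trans bc cd)//= lerDr.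
by apply: sumr_ge0 => i _; exact: step_ge0.
Qed.

Lemma chord_le g N a b : (a <= b)%N ->
  normc (g (a%:R / N%:R) - g (b%:R / N%:R)) <= \sum_(a <= i < b) step g N i.
Proof.
move=> /subnK <-; elim: (b - a)%N => [|k ih].
  by rewrite add0n subrr normc0 big_geq.
rewrite addSn big_nat_recr ?leq_addl//=.
by apply: le_trans (normcB_le _ (g ((k + a)%:R / N%:R)) _ _) _; rewrite lerD2r.
Qed.

(** The triangle inequality splits each chord in two. With N = 2^k, the halves have indices from 2
    up to 2N - 3, within the range from 1 to 2N - 2 kept at the next level. *)
Lemma dyadic_lengthS g k : dyadic_length g k <= dyadic_length g k.+1.
Proof.
rewrite /dyadic_length; set N := (2 ^ k)%N.
have -> : (2 ^ k.+1)%N = (2 * N)%N by rewrite expnS.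
have N0 : (0 < N)%N by rewrite expn_gt0.
have NR : 0 < N%:R :> R by rewrite ltr0n.
have double n : \sum_(1 <= j < n) \sum_(2 * j <= i < 2 * j.+1) step g (2 * N) i =
    \sum_(2 <= i < 2 * maxn 1 n) step g (2 * N) i.
  elim: n => [|[|n] ih]; first by rewrite maxn0 !big_geq.
    by rewrite maxnn !big_geq.
  rewrite big_nat_recr//= ih !(maxn_idPr _)//.
  by rewrite -big_cat_nat//; lia.
apply: (@le_trans _ _ (\sum_(1 <= j < N.-1)
    \sum_(2 * j <= i < 2 * j.+1) step g (2 * N) i)).
  apply: ler_sum => j _; apply: le_trans (chord_le _ _ _ _ _); last by lia.
  have e i : (2 * i)%:R / (2 * N)%:R = i%:R / N%:R :> R.
    by rewrite !natrM -mulf_div divff// mul1r.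
  by rewrite !e.
rewrite double; have [N2|N2] := leqP N 2.
  by rewrite big_geq ?sumr_ge0// => [i _|]; [exact: step_ge0|lia].
by apply: sum_step_widen => //; lia.
Qed.

Lemma dyadic_length_homo g k l : (k <= l)%N -> dyadic_length g k <= dyadic_length g l.
Proof.
move=> /subnK <-; elim: (l - k)%N => [//|d ih].
by rewrite addSn (le_trans ih)// dyadic_lengthS.
Qed.

Lemma continuous_dyadic_length (F : R -> R -> C) k :
  (forall t, continuous (fun x => F x t)) ->
  continuous (fun x => dyadic_length (F x) k).
Proof.
move=> cF; rewrite /dyadic_length.
elim: (2 ^ k).-1 => [|n ih].
  have -> : (fun x => \sum_(1 <= j < 0) step (F x) (2 ^ k) j) = fun=> 0.
    by apply/funext => x; rewrite big_geq.
  exact: cst_continuous.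
have [->|n0] := posnP n.
  have -> : (fun x => \sum_(1 <= j < 1) step (F x) (2 ^ k) j) = fun=> 0.
    by apply/funext => x; rewrite big_geq.
  exact: cst_continuous.
have -> : (fun x => \sum_(1 <= j < n.+1) step (F x) (2 ^ k) j) =
    fun x => \sum_(1 <= j < n) step (F x) (2 ^ k) j + step (F x) (2 ^ k) n.
  by apply/funext => x; rewrite big_nat_recr.
apply: continuous_addr => // x.
apply/cvgrPdist_lt => e e0.
have e2 : 0 < e / 2 by rewrite divr_gt0.
have near0 t : \forall y \near x, normc (F y t - F x t) < e / 2.
  have : nbhs (F x t) [set z | normc (z - F x t) < e / 2].
    by apply/nbhs_normcP; exists (e / 2).
  by move=> /cF.
near=> y.
have h1 : normc (F y (n%:R / (2 ^ k)%:R) - F x (n%:R / (2 ^ k)%:R)) < e / 2.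
  by near: y; exact: near0.
have h2 : normc (F y (n.+1%:R / (2 ^ k)%:R) - F x (n.+1%:R / (2 ^ k)%:R)) < e / 2.
  by near: y; exact: near0.
rewrite /step; apply: le_lt_trans (normcB_le_norm _ _ _) _.
rewrite opprB addrACA addrC [X in normc X]addrC addrACA.
rewrite (_ : _ + _ = (F x (n%:R / (2 ^ k)%:R) - F y (n%:R / (2 ^ k)%:R)) +
  (F y (n.+1%:R / (2 ^ k)%:R) - F x (n.+1%:R / (2 ^ k)%:R))); last by ring.
apply: le_lt_trans (normcD_le _ _ _) _; rewrite normc_sub; lra.
Unshelve. all: by end_near. Qed.

(** At a cluster point of the lines a length above [Z] at level [k] would persist on a neighbourhood
    by continuity. Lines of later levels enter this neighbourhood, and their level [k] length is at
    most [Z] by monotonicity. *)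
Lemma limit_line (F : R -> R -> C) (a b Z : R) (k0 : nat) :
  (forall t, continuous (fun x => F x t)) ->
  (forall k, (k0 <= k)%N -> exists2 x, a <= x <= b & dyadic_length (F x) k <= Z) ->
  exists2 x, a <= x <= b & forall k, dyadic_length (F x) k <= Z.
Proof.
move=> cF H.
have H' k : exists x, a <= x <= b /\ dyadic_length (F x) (maxn k0 k) <= Z.
  by have [x ? ?] := H _ (leq_maxl k0 k); exists x.
have [u uP] := choice H'.
have [|x [xab xcl]] := @segment_compact R a b (u @ \oo) _.
  by exists 0%N => // k _ /=; rewrite in_itv/=; have [] := uP k.
exists x; first by move: xab; rewrite /= in_itv.
move=> k; rewrite leNgt; apply/negP => Zk.
have nb : nbhs x [set y | Z < dyadic_length (F y) k].
  exact: (continuous_dyadic_length F k cF x _ (open_nbhs_nbhs (conj (@open_gt _ Z) Zk))).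
have ev : (u @ \oo) [set y | dyadic_length (F y) k <= Z].
  exists k => // l /= kl; have [_] := uP l; apply: le_trans.
  by apply: dyadic_length_homo; rewrite leq_max kl orbT.
have [y [/= ]] := xcl _ _ ev nb.
by rewrite leNgt => /negbTE ->.
Qed.

Section Bound.
Variables (g : R -> C) (Z : R).
Hypotheses (g_cont : continuous g) (g_len : forall k, dyadic_length g k <= Z).

(** For k > 0 the clamping selects exactly the nodes that [dyadic_length] uses, so 0 and 1 are
    approximated from inside. *)
Definition dyadic_index (k : nat) (t : R) : nat :=
  maxn 1 (minn (2 ^ k).-1 (Num.truncn (t * (2 ^ k)%:R))).

Definition dyadic_approx (k : nat) (t : R) : R := (dyadic_index k t)%:R / (2 ^ k)%:R.

Lemma dyadic_index_le k t u : t <= u -> (dyadic_index k t <= dyadic_index k u)%N.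
Proof.
move=> tu; rewrite /dyadic_index geq_max leq_maxl/= leq_max; apply/orP; right.
rewrite leq_min geq_minl/= (leq_trans (geq_minr _ _))//.
by apply: le_truncn; rewrite ler_wpM2r.
Qed.

Lemma dyadic_approx_dist k t : 0 <= t <= 1 -> `|dyadic_approx k.+1 t - t| <= (2 ^ k.+1)%:R^-1.
Proof.
move=> /andP[t0 t1]; rewrite /dyadic_approx /dyadic_index; set N := (2 ^ k.+1)%N.
have N2 : (2 <= N)%N by rewrite /N expnS leq_pmulr// expn_gt0.
have NR : 0 < N%:R :> R by rewrite ltr0n; lia.
have tN0 : 0 <= t * N%:R by rewrite mulr_ge0.
have /andP[tr1 tr2] := truncn_itv tN0.
set T := Num.truncn _ in tr1 tr2 *.
have tNN : t * N%:R <= N%:R by rewrite ler_piMl.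
have TN : (T <= N)%N by rewrite -(ler_nat R); lra.
have -> : (maxn 1 (minn N.-1 T))%:R / N%:R - t =
    ((maxn 1 (minn N.-1 T))%:R - t * N%:R) / N%:R.
  by rewrite mulrBl mulfK// gt_eqF.
rewrite normrM [X in _ * X]gtr0_norm ?invr_gt0// ler_piMl ?invr_ge0 ?ler0n//.
rewrite ler_norml; have [T0|T0] : (0 < T)%N \/ T = 0%N by lia.
  have [TN'|TN'] : (T <= N.-1)%N \/ (N.-1 < T)%N by lia.
    have -> : maxn 1 (minn N.-1 T) = T by lia.
    by rewrite -natr1 in tr2; lra.
  have TE : T = N by lia.
  have -> : maxn 1 (minn N.-1 T) = N.-1 by lia.
  have : N.-1%:R + 1 = N%:R :> R by rewrite natr1 prednK//; lia.
  by rewrite TE in tr1; lra.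
have -> : maxn 1 (minn N.-1 T) = 1%N by lia.
by rewrite T0 in tr2; lra.
Qed.

Lemma dyadic_approx_cvg t : 0 <= t <= 1 -> dyadic_approx k t @[k --> \oo] --> t.
Proof.
move=> t01; apply/cvgrPdist_lt => e e0.
have [n _ nP] := near_infty_natSinv_expn_lt (PosNum e0).
exists n.+1 => // k /= nk; rewrite distrC.
have -> : k = k.-1.+1 by lia.
apply: le_lt_trans (dyadic_approx_dist _ _ t01) _.
have := nP k; rewrite /= => /(_ (ltnW nk)); rewrite div1r natrX.
by have -> : k.-1.+1 = k by lia.
Qed.

Lemma inscribed_cvg (s : seq R) (x : R) : all (fun t => 0 <= t <= 1) (x :: s) ->
  \sum_(p <- zip s (x :: s))
     normc (g (dyadic_approx k p.1) - g (dyadic_approx k p.2)) @[k --> \oo] -->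
  \sum_(p <- zip s (x :: s)) normc (g p.1 - g p.2).
Proof.
elim: s x => [|y s ih] x /=.
  move=> _; rewrite big_nil; under eq_fun do rewrite big_nil; exact: cvg_cst.
move=> /and3P[x01 y01 s01].
rewrite big_cons; under eq_fun do rewrite big_cons.
apply: cvgD; last by apply: ih; rewrite /= y01.
apply/cvgrPdist_lt => e e0.
have e2 : 0 < e / 2 by rewrite divr_gt0.
have near0 t : 0 <= t <= 1 -> \forall k \near \oo, normc (g (dyadic_approx k t) - g t) < e / 2.
  move=> t01; have : nbhs (g t) [set z | normc (z - g t) < e / 2].
    by apply/nbhs_normcP; exists (e / 2).
  by move=> /g_cont /(dyadic_approx_cvg t t01).
near=> k.
have h1 : normc (g (dyadic_approx k x) - g x) < e / 2 by near: k; exact: near0.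
have h2 : normc (g (dyadic_approx k y) - g y) < e / 2 by near: k; exact: near0.
apply: le_lt_trans (normcB_le_norm _ _ _) _.
rewrite (_ : _ - _ = (g y - g (dyadic_approx k y)) + (g (dyadic_approx k x) - g x)); last by ring.
apply: le_lt_trans (normcD_le _ _ _) _; rewrite normc_sub; lra.
Unshelve. all: by end_near. Qed.

Lemma inscribed_approx_le (k : nat) (s : seq R) (x : R) : path <%R x s ->
  \sum_(p <- zip s (x :: s))
     normc (g (dyadic_approx k p.1) - g (dyadic_approx k p.2)) <=
  \sum_(dyadic_index k x <= i < dyadic_index k (last x s)) step g (2 ^ k) i.
Proof.
elim: s x => [|y s ih] x /=; first by rewrite big_nil big_geq.
move=> /andP[xy ys]; rewrite big_cons.
have xyI := dyadic_index_le k _ _ (ltW xy).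
have ysI : (dyadic_index k y <= dyadic_index k (last y s))%N.
  apply: dyadic_index_le; elim: (s) (y) ys => //= z s' ih' v /andP[vz /ih'].
  exact: le_trans (ltW vz).
rewrite (big_cat_nat (n := dyadic_index k y))//=; apply: lerD (ih _ ys).
by rewrite normc_sub; exact: chord_le.
Qed.

(** The nodes of an arbitrary partition are moved to dyadic ones, where the trimmed length bounds
    the sum, and continuity of [g] returns the original sum in the limit. This also recovers the two
    omitted ends. *)
Lemma arc_length_le : (arc_length g <= Z%:E)%E.
Proof.
apply: ge_ereal_sup => _ [s [s_path /eqP s_last] <-]; rewrite lee_fin.
have s01 : all (fun t => 0 <= t <= 1) (0 :: s).
  have : forall x : R, 0 <= x -> path <%R x s -> last x s = 1 ->
      all (fun t => 0 <= t <= 1) (x :: s).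
    elim: s {s_path s_last} => [|y s ih] x x0 /=; first by move=> _ ->; rewrite ler01 lexx.
    move=> /andP[xy ys] l; have /= := ih _ (le_trans x0 (ltW xy)) ys l.
    by move=> /andP[/andP[y0 y1] ->]; rewrite x0 y0 y1 (le_trans (ltW xy) y1).
  by apply.
rewrite -(cvg_lim _ (inscribed_cvg s 0 s01))//.
apply: limr_le; first by apply/cvg_ex; eexists; exact: inscribed_cvg.
near=> k; apply: le_trans (inscribed_approx_le k s 0 s_path) _.
apply: le_trans (g_len k); rewrite s_last.
apply: sum_step_widen; first exact: leq_maxl.
  exact: dyadic_index_le.
rewrite /dyadic_index geq_max geq_minl andbT.
have k1 : (1 <= k)%N by near: k; exists 1%N.
have : (2 ^ 1 <= 2 ^ k)%N by rewrite leq_pexp2l.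
by lia.
Unshelve. all: by end_near. Qed.

End Bound.
End ArcLength.

(** * The extended inverse map, the sides, and images of lines as crosscuts *)

Section Modulus.
Variable R : realType.
Local Notation C := (plane R).
Local Notation Re := (@complex.Re R).
Local Notation Im := (@complex.Im R).
Local Notation I01 := (`[(0 : R), (1 : R)]%classic : set R).

Lemma continuous_within_comp (T U V : topologicalType) (A : set U)
    (f : T -> U) (g : U -> V) :
  continuous f -> (forall t, A (f t)) -> {within A, continuous g} ->
  continuous (fun t => g (f t)).
Proof.
move=> cf fA /subspace_continuousP cg t B nB.
have H : nbhs t (f @^-1` [set u | A u -> B (g u)]) by exact/cf/(cg _ (fA t) _ nB).
by apply: filterS H => u /= h; exact: h (fA u).
Qed.

Lemma dyadic_length_rev (g : R -> C) k :
  dyadic_length R (fun t => g (1 - t)) k = dyadic_length R g k.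
Proof.
rewrite /dyadic_length big_nat_rev/= big_nat [RHS]big_nat; apply: eq_bigr => i.
set N := (2 ^ k)%N => /andP[i1 iN].
have NR : (N%:R : R) != 0 by rewrite pnatr_eq0; lia.
have rev (j : nat) : (j <= N)%N -> 1 - (N - j)%:R / N%:R = j%:R / N%:R :> R.
  by move=> jN; rewrite natrB// mulrBl divff// opprB addrC subrK.
rewrite /step normc_sub.
have -> : (1 + N.-1 - i.+1).+1 = (N - i)%N by lia.
have -> : (1 + N.-1 - i.+1)%N = (N - i.+1)%N by lia.
by rewrite !rev//; lia.
Qed.

Definition clamp (a x : R) : R := Num.max 0 (Num.min a x).

Lemma clamp_id a x : 0 <= x <= a -> clamp a x = x.
Proof. by move=> /andP[x0 xa]; rewrite /clamp min_r// max_r. Qed.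

Lemma clamp_itv a x : 0 <= a -> 0 <= clamp a x <= a.
Proof. by move=> a0; rewrite /clamp le_max lexx/= ge_max a0 ge_min lexx. Qed.

Lemma continuous_clamp a : continuous (clamp a).
Proof.
apply: continuous_maxr; first exact: cst_continuous.
by apply: continuous_minr; [exact: cst_continuous|move=> x; exact: cvg_id].
Qed.

Definition closed_rect (M : R) (z : C) : bool := (0 <= Re z <= M) && (0 <= Im z <= 1).

Lemma closed_rect_closure M z : 0 < M -> closed_rect M z -> closure (rectangle M) z.
Proof.
move=> M0 /andP[/andP[x0 xM] /andP[y0 y1]] B /nbhs_normcP[e e0 eB].
have M1 : 0 < M + 1 by rewrite addr_gt0.
(* The point is moved towards the center of the rectangle by the fraction [s], a displacement of at
   most s (M + 1). *)
pose s := Num.min (1 / 2) (e / (M + 1) / 2).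
have s0 : 0 < s by rewrite lt_min !divr_gt0.
have s2 : s <= 1 / 2 by rewrite ge_min lexx.
have se : s * (M + 1) < e.
  rewrite -ltr_pdivlMr//; have : s <= e / (M + 1) / 2 by rewrite ge_min lexx orbT.
  have : 0 < e / (M + 1) by rewrite divr_gt0.
  by lra.
exists ((Re z + s * (M / 2 - Re z)) +i* (Im z + s * (1 / 2 - Im z))); split.
  have a1 : 0 <= (1 - s) * Re z by rewrite mulr_ge0//; lra.
  have a2 : (1 - s) * Re z <= (1 - s) * M by rewrite ler_wpM2l//; lra.
  have a3 : 0 <= (1 - s) * Im z by rewrite mulr_ge0//; lra.
  have a4 : (1 - s) * Im z <= (1 - s) * 1 by rewrite ler_wpM2l//; lra.
  have a5 : 0 < s * M by rewrite mulr_gt0.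
  by split; apply/andP; split => /=; lra.
apply: eB; apply: le_lt_trans (normc_le_ReIm _ _) _; rewrite ReB ImB/=.
rewrite ![_ + s * _ - _]addrAC !subrr !add0r !normrM gtr0_norm// -mulrDr.
apply: le_lt_trans se; rewrite ler_pM2l//.
have : `|M / 2 - Re z| <= M by rewrite ler_norml; lra.
have : `|1 / 2 - Im z| <= 1 by rewrite ler_norml; lra.
by lra.
Qed.

Lemma normc_cis t : normc (cis t : C) = 1.
Proof. by rewrite /cis/= cos2Dsin2 sqrtr1. Qed.

Lemma vertices_boundary (Q : quadrilateral R) :
  [/\ boundary (dom Q) (v1 Q), boundary (dom Q) (v2 Q),
      boundary (dom Q) (v3 Q) & boundary (dom Q) (v4 Q)].
Proof.
have [gam [[<- _ _] _ [t1 [t2 [t3 [t4 [_ [-> -> -> ->]]]]]]]] := dom_jordan Q.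
by split; [exists (cis t1)|exists (cis t2)|exists (cis t3)|exists (cis t4)] => //;
  exact: normc_cis.
Qed.

Lemma arc_length_ge0 (g : R -> C) : (0 <= arc_length g)%E.
Proof.
apply: (@le_trans _ _ (\sum_(x <- zip [:: 1] [:: 0; 1]) normc (g x.1 - g x.2))%:E).
  by rewrite lee_fin sumr_ge0// => x _; exact: normc_ge0.
by apply: ereal_sup_ubound; exists [:: 1] => //; split => //=; rewrite ltr01.
Qed.

Lemma distance_within_ge0 (D A B : set C) : (0 <= distance_within D A B)%E.
Proof. by apply: le_ereal_inf_tmp => _ [g _ <-]; exact: arc_length_ge0. Qed.

Section Quadrilateral.
Variables (Q : quadrilateral R) (M : R) (phi g : C -> C).
Hypotheses (M_gt0 : 0 < M) (hol : holomorphic_on (dom Q) phi)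
  (phi_dom : phi @` dom Q = rectangle M)
  (phi_closure : phi @` closure (dom Q) = closure (rectangle M))
  (phi_cont : {within closure (dom Q), continuous phi})
  (g_cont : {within closure (rectangle M), continuous g})
  (gK : forall x, closure (dom Q) x -> g (phi x) = x).

(** Precomposing with the retraction of the plane onto the closed rectangle gives a map continuous
    everywhere, although [g] is continuous only within that rectangle. *)
Definition inverse_chart (z : C) : C := g (clamp M (Re z) +i* clamp 1 (Im z)).
Local Notation G := inverse_chart.

Lemma inverse_chart_closed z : closed_rect M z ->
  closure (dom Q) (G z) /\ phi (G z) = z.
Proof.
move=> zM; have := closed_rect_closure M z M_gt0 zM; rewrite -phi_closure.
move: zM => /andP[zx zy] [w cw wz].
have Gz : G z = w.
  by rewrite /G (clamp_id _ _ zx) (clamp_id _ _ zy) -(gK _ cw) wz; case: (z).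
by rewrite Gz.
Qed.

Lemma inverse_chart_open z : open_rect R M z -> dom Q (G z) /\ phi (G z) = z.
Proof.
move=> /andP[zx zy]; have : rectangle M z by split.
rewrite -phi_dom => -[w Qw wz].
have [/andP[? ?] /andP[? ?]] := (zx, zy).
have [cG phiG] : closure (dom Q) (G z) /\ phi (G z) = z.
  by apply: inverse_chart_closed; rewrite /closed_rect !ltW.
have Gz : G z = w.
  exact: etrans (esym (gK _ cG)) (etrans (congr1 g (etrans phiG (esym wz)))
    (gK _ (subset_closure Qw))).
by rewrite Gz.
Qed.

Lemma phi_open_rect w : dom Q w -> open_rect R M (phi w).
Proof.
move=> Qw; have : rectangle M (phi w) by rewrite -phi_dom; exists w.
by move=> [? ?]; apply/andP.
Qed.

Lemma inverse_chartK w : closure (dom Q) w -> closed_rect M (phi w) -> G (phi w) = w.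
Proof.
move=> cw pw; have [cG pG] := inverse_chart_closed _ pw.
exact: etrans (esym (gK _ cG)) (etrans (congr1 g pG) (gK _ cw)).
Qed.

Lemma inverse_chart_boundary z : closed_rect M z -> ~~ open_rect R M z ->
  boundary (dom Q) (G z).
Proof.
move=> /inverse_chart_closed[cG pG] nz; split => //.
rewrite (_ : (dom Q)° = dom Q); last exact/interior_id/dom_open.
by move=> /phi_open_rect; rewrite pG (negbTE nz).
Qed.

Lemma continuous_inverse_chart : continuous G.
Proof.
pose cx (z : C) : R := clamp M (Re z); pose cy (z : C) : R := clamp 1 (Im z).
have cxP : continuous cx.
  exact: (continuous_fun_comp C R R _ _ (@continuous_Re R) (continuous_clamp M)).
have cyP : continuous cy.
  exact: (continuous_fun_comp C R R _ _ (@continuous_Im R) (continuous_clamp 1)).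
have inA z : closure (rectangle M) (cx z +i* cy z).
  apply: closed_rect_closure => //; rewrite /closed_rect/=.
  by rewrite !clamp_itv// ltW.
exact: (continuous_within_comp C C C _ _ g (continuous_Complex R C cx cy cxP cyP)
  inA g_cont).
Qed.

Lemma inverse_chart_chart : conformal_chart R (dom Q) phi G M.
Proof.
split.
- exact: M_gt0.
- by apply: open_normcP; exact: dom_open.
- by move=> c Qc; exact/derivable_normc/hol.
- move=> w Qw; have pw := phi_open_rect _ Qw; split; first exact: pw.
  apply: inverse_chartK; first exact: subset_closure.
  by case/andP: pw => /andP[? ?] /andP[? ?]; rewrite /closed_rect !ltW.
- exact: inverse_chart_open.
(* At a boundary point the image lies off the open rectangle, and continuity of [phi] on the closure
   keeps nearby images out of the inner one. Off the closure there are no nearby points of the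
   domain. *)
- move=> c nQc t t0; have [cc|ncc] := pselect (closure (dom Q) c).
    have [d d0 dP] := within_normcP _ _ _ _ phi_cont cc _ t0.
    exists d => // w Qw wd; apply/negP => /andP[/andP[x1 x2] /andP[y1 y2]].
    have wc := dP _ (subset_closure Qw) wd.
    have := le_lt_trans (Re_le_normc _ _) wc; have := le_lt_trans (Im_le_normc _ _) wc.
    rewrite ReB ImB !ltr_norml => /andP[? ?] /andP[? ?].
    have pc : open_rect R M (phi c).
      by rewrite /open_rect; apply/andP; split; apply/andP; split; lra.
    apply: nQc; have [QG _] := inverse_chart_open _ pc.
    rewrite -(inverse_chartK c)//.
    by case/andP: pc => /andP[? ?] /andP[? ?]; rewrite /closed_rect !ltW.
  have [d d0 dP] := closure_normcP _ _ _ ncc.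
  by exists d => // w /dP /negP.
- exact: continuous_inverse_chart.
- have [B [Breal BP]] := dom_bounded Q.
  exists (Re (B + 1)) => w Qw.
  have B1 : B < B + 1 by rewrite ltrDl.
  have : `|w| <= B + 1 := BP _ B1 w Qw.
  rewrite normr_plane lecE => /andP[_].
  by [].
Qed.

(** The coordinate [l] reads the parameter off a point of the line, so [l] after [phi] is a
    continuous inverse on the image. *)
Lemma line_homeomorphism (z : R -> C) (l : C -> R) :
  continuous z -> continuous l -> (forall t, 0 <= t <= 1 -> closed_rect M (z t)) ->
  (forall t, 0 <= t <= 1 -> l (z t) = t) ->
  homeomorphism_on I01 ((fun t => G (z t)) @` I01) (fun t => G (z t)).
Proof.
move=> cz cl zM lz; split; first exact: erefl.
  apply: continuous_subspaceT.
  exact: (continuous_fun_comp _ _ _ _ _ cz continuous_inverse_chart).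
exists (fun w => l (phi w)); split; last first.
  move=> t /=; rewrite in_itv/= => t01.
  by have [_ ->] := inverse_chart_closed _ (zM t t01); exact: lz.
have sub : (fun t => G (z t)) @` I01 `<=` closure (dom Q).
  move=> _ [t + <-]; rewrite /= in_itv/= => t01.
  by have [] := inverse_chart_closed _ (zM t t01).
have cphi := continuous_subspaceW sub phi_cont.
by move=> w; apply: (continuous_comp (cphi w)); exact: cl.
Qed.

Hypotheses
  (phi_v1 : phi (v1 Q) = 0) (phi_v2 : phi (v2 Q) = M%:C)
  (phi_v3 : phi (v3 Q) = M +i* 1) (phi_v4 : phi (v4 Q) = 0 +i* 1).

Lemma side_line (z : R -> C) (l : C -> R) (u v : C) :
  continuous z -> continuous l -> (forall t, 0 <= t <= 1 -> closed_rect M (z t)) ->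
  (forall t, 0 <= t <= 1 -> l (z t) = t) ->
  (forall t, 0 <= t <= 1 -> ~~ open_rect R M (z t)) ->
  closure (dom Q) u -> closure (dom Q) v -> z 0 = phi u -> z 1 = phi v ->
  (forall t, 0 <= t <= 1 ->
     z t \in [:: 0; M%:C; M +i* 1; 0 +i* 1 : C] -> t = 0 \/ t = 1) ->
  forall t, 0 <= t <= 1 -> side Q u v (G (z t)).
Proof.
move=> cz cl zM lz nz cu cv z0 z1 corner t t01.
have Gu : G (z 0) = u by rewrite z0 inverse_chartK// -z0 zM// lexx ler01.
have Gv : G (z 1) = v by rewrite z1 inverse_chartK// -z1 zM// lexx ler01.
exists ((fun t => G (z t)) @` I01); split.
- exists (fun t => G (z t)); split; [|exact: Gu|exact: Gv].
  exact: (line_homeomorphism z l cz cl zM lz).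
- move=> _ [s + <-]; rewrite /= in_itv/= => s01.
  by apply: inverse_chart_boundary; [exact: zM|exact: nz].
- move=> w wv [s + sw]; rewrite /= in_itv/= => s01.
  have [_ ps] := inverse_chart_closed _ (zM s s01).
  have : z s \in [:: 0; M%:C; M +i* 1; 0 +i* 1 : C].
    rewrite -ps sw -phi_v1 -phi_v2 -phi_v3 -phi_v4.
    by move: wv; rewrite !inE => /or4P[] /eqP ->; rewrite eqxx ?orbT.
  by move=> /(corner s s01)[E|E]; rewrite -sw E; [left|right].
- by exists t => //=; rewrite in_itv.
Qed.

Lemma vertices_closure : [/\ closure (dom Q) (v1 Q), closure (dom Q) (v2 Q),
  closure (dom Q) (v3 Q) & closure (dom Q) (v4 Q)].
Proof. by have [[? _] [? _] [? _] [? _]] := vertices_boundary Q. Qed.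

Let cst_c (a : R) : continuous (fun _ : R => a). Proof. exact: cst_continuous. Qed.
Let id_c : continuous (fun t : R => t). Proof. by move=> t; exact: cvg_id. Qed.
Let rev_c : continuous (fun t : R => 1 - t).
Proof. by move=> t; apply: cvgB; [exact: cvg_cst|exact: cvg_id]. Qed.
Let scale_c (f : R -> R) : continuous f -> continuous (fun t => M * f t).
Proof. by move=> cf t; apply: cvgM; [exact: cvg_cst|exact: cf]. Qed.
Let unscale_c : continuous (fun z : C => Re z / M).
Proof.
have cm : continuous (fun x : R => x / M).
  by move=> x; apply: cvgM; [exact: cvg_id|exact: cvg_cst].
exact: (continuous_fun_comp C R R Re (fun x => x / M) (@continuous_Re R) cm).
Qed.

Let in_scale (t : R) : 0 <= t <= 1 -> 0 <= M * t <= M.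
Proof.
by move=> /andP[t0 t1]; rewrite mulr_ge0 ?(ltW M_gt0)//= ler_piMr// ltW.
Qed.

Let rev01 (t : R) : 0 <= t <= 1 -> 0 <= 1 - t <= 1.
Proof. by move=> /andP[? ?]; apply/andP; split; lra. Qed.

Let M_neq0 : M != 0. Proof. by rewrite gt_eqF. Qed.

Lemma side_bottom t : 0 <= t <= 1 -> side Q (v1 Q) (v2 Q) (G ((M * t) +i* 0)).
Proof.
have [c1 c2 _ _] := vertices_closure.
have cz : continuous ((fun t => (M * t) +i* 0) : R -> C) by exact: (continuous_Complex _ _ _ _ (scale_c _ id_c) (cst_c 0)).
have cl : continuous ((fun z => Re z / M) : C -> R) by exact: unscale_c.
apply: (side_line (fun t => (M * t) +i* 0) (fun z => Re z / M) _ _ cz cl).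
- by move=> {}t t01; rewrite /closed_rect/= in_scale// lexx ler01.
- by move=> {}t _ /=; rewrite mulrC mulKf.
- by move=> {}t _; rewrite /open_rect/= ltxx andbF.
- exact: c1.
- exact: c2.
- by rewrite phi_v1 mulr0.
- by rewrite phi_v2 mulr1.
- move=> {}t _; rewrite !inE !eq_complex/= ![0 == 1]eq_sym oner_eq0 !andbF !orbF eqxx !andbT.
  rewrite mulf_eq0 (negbTE M_neq0)/= => /orP[/eqP|/eqP h]; first by left.
  by right; apply: (mulfI M_neq0); rewrite mulr1.
Qed.

Lemma side_top t : 0 <= t <= 1 -> side Q (v3 Q) (v4 Q) (G ((M * (1 - t)) +i* 1)).
Proof.
have [_ _ c3 c4] := vertices_closure.
have cz : continuous ((fun t => (M * (1 - t)) +i* 1) : R -> C) by exact: (continuous_Complex _ _ _ _ (scale_c _ rev_c) (cst_c 1)).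
have cl : continuous ((fun z => 1 - Re z / M) : C -> R) by exact: (continuous_fun_comp _ _ _ _ _ unscale_c rev_c).
apply: (side_line (fun t => (M * (1 - t)) +i* 1) (fun z => 1 - Re z / M) _ _ cz cl).
- by move=> {}t t01; rewrite /closed_rect/= in_scale ?rev01// lexx ler01.
- by move=> {}t _ /=; rewrite [M * _]mulrC mulfK// opprB addrC subrK.
- by move=> {}t _; rewrite /open_rect/= ltxx !andbF.
- exact: c3.
- exact: c4.
- by rewrite phi_v3 subr0 mulr1.
- by rewrite phi_v4 subrr mulr0.
- move=> {}t _; rewrite !inE !eq_complex/= oner_eq0 !andbF/= eqxx !andbT.
  rewrite mulf_eq0 (negbTE M_neq0)/= => /orP[/eqP h|/eqP h].
    left; have : 1 - t = 1 by apply: (mulfI M_neq0); rewrite mulr1.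
    by lra.
  by right; lra.
Qed.

Lemma side_right t : 0 <= t <= 1 -> side Q (v2 Q) (v3 Q) (G (M +i* t)).
Proof.
have [_ c2 c3 _] := vertices_closure.
have cz : continuous ((fun t => M +i* t) : R -> C) by exact: (continuous_Complex _ _ _ _ (cst_c M) id_c).
have cl : continuous (Im : C -> R) by exact: (@continuous_Im R).
apply: (side_line (fun t => M +i* t) Im _ _ cz cl).
- by move=> {}t t01; rewrite /closed_rect/= t01 lexx ltW.
- by move=> {}t _.
- by move=> {}t _; rewrite /open_rect/= ltxx andbF.
- exact: c2.
- exact: c3.
- by rewrite phi_v2.
- by rewrite phi_v3.
- move=> {}t _; rewrite !inE !eq_complex/= (negbTE M_neq0) eqxx/= orbF.
  by move=> /orP[] /eqP; [left|right].
Qed.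

Lemma side_left t : 0 <= t <= 1 -> side Q (v4 Q) (v1 Q) (G (0 +i* (1 - t))).
Proof.
have [c1 _ _ c4] := vertices_closure.
have cz : continuous ((fun t => 0 +i* (1 - t)) : R -> C) by exact: (continuous_Complex _ _ _ _ (cst_c 0) rev_c).
have cl : continuous ((fun z => 1 - Im z) : C -> R) by exact: (continuous_fun_comp _ _ _ _ _ (@continuous_Im R) rev_c).
apply: (side_line (fun t => 0 +i* (1 - t)) (fun z => 1 - Im z) _ _ cz cl).
- by move=> {}t t01; rewrite /closed_rect/= rev01// lexx ltW.
- by move=> {}t _ /=; rewrite opprB addrC subrK.
- by move=> {}t _; rewrite /open_rect/= ltxx.
- exact: c4.
- exact: c1.
- by rewrite phi_v4 subr0.
- by rewrite phi_v1 subrr.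
- move=> {}t _; rewrite !inE !eq_complex/= ![0 == M]eq_sym (negbTE M_neq0) eqxx/=.
  by move=> /orP[/eqP h|/eqP h]; [right|left]; lra.
Qed.

Let on_line (a x : R) : 0 < a -> 0 <= x <= a -> exists2 t, 0 <= t <= 1 & x = a * t.
Proof.
move=> a0 /andP[x0 xa]; exists (x / a); last by rewrite mulrC divfK// gt_eqF.
by rewrite divr_ge0 ?(ltW a0)//= ler_pdivrMr// mul1r.
Qed.

Lemma s_a_le x (Z : R) : 0 < x < M ->
  (forall k, dyadic_length R (fun t => G (x +i* t)) k <= Z) -> (s_a Q <= Z%:E)%E.
Proof.
move=> /andP[x0 xM] len; have xI : 0 <= x <= M by rewrite !ltW.
have cl : continuous (fun t => (x +i* t) : C) by exact: continuous_Complex.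
apply: (@le_trans _ _ (arc_length (fun t => G (x +i* t)))); last first.
  apply: arc_length_le; last exact: len.
  exact: (continuous_fun_comp _ _ _ _ _ cl continuous_inverse_chart).
apply: ereal_inf_lbound; exists (fun t => G (x +i* t)); last exact: erefl.
split.
- apply: (line_homeomorphism (fun t => x +i* t) Im) => //; first exact: continuous_Im.
  by move=> t t01; rewrite /closed_rect/= xI.
- move=> t /andP[t0 t1]; apply: (inverse_chart_open (x +i* t) _).1.
  by rewrite /open_rect/= x0 xM t0 t1.
- by have [t t01 ->] := on_line _ _ M_gt0 xI; exact: side_bottom.
- have [t t01 ->] := on_line _ _ M_gt0 xI.
  by have := side_top _ (rev01 _ t01); rewrite opprB addrC subrK.
Qed.

Lemma s_b_le y (Z : R) : 0 < y < 1 ->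
  (forall k, dyadic_length R (fun t => G ((M * t) +i* y)) k <= Z) -> (s_b Q <= Z%:E)%E.
Proof.
move=> /andP[y0 y1] len; have yI : 0 <= y <= 1 by rewrite !ltW.
(* Crosscuts for [s_b] start on the side from [v2] to [v3], the right edge, so the line is run
   backwards; [dyadic_length_rev] transfers the bound. *)
pose z t : C := (M * (1 - t)) +i* y.
have cl : continuous z by apply: continuous_Complex; [exact/scale_c|].
apply: (@le_trans _ _ (arc_length (fun t => G (z t)))); last first.
  apply: arc_length_le => [|k].
    exact: (continuous_fun_comp _ _ _ _ _ cl continuous_inverse_chart).
  by rewrite (dyadic_length_rev (fun t => G ((M * t) +i* y))).
apply: ereal_inf_lbound; exists (fun t => G (z t)); last exact: erefl.
split.
- apply: (line_homeomorphism z (fun z => 1 - Re z / M)) => //.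
  + exact: (continuous_fun_comp _ _ _ _ _ unscale_c rev_c).
  + by move=> t t01; rewrite /closed_rect/= yI andbT in_scale// rev01.
  + by move=> t _ /=; rewrite [M * _]mulrC mulfK// opprB addrC subrK.
- move=> t /andP[t0 t1]; apply: (inverse_chart_open (z t) _).1.
  have h1 : 0 < M * (1 - t) by rewrite mulr_gt0// subr_gt0.
  have h2 : M * (1 - t) < M * 1 by rewrite ltr_pM2l// ltrBlDr ltrDl.
  by rewrite mulr1 in h2; rewrite /open_rect/= h1 h2 y0 y1.
- by rewrite /z subr0 mulr1; exact: side_right.
- rewrite /z subrr mulr0.
  by have := side_left _ (rev01 _ yI); rewrite opprB addrC subrK.
Qed.

End Quadrilateral.

(** Double the radius [e] until the disk first leaves [Q]: the last disk inside and the first one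
    outside give D/2 and D. This replaces the distance to the boundary, up to a factor 2. *)
Lemma inscribed_disk_scale (Q : set C) (w0 : C) (e B : R) : Q w0 -> 0 < e ->
  (forall w, normc (w - w0) < e -> Q w) -> (forall w, Q w -> normc w <= B) ->
  exists D : R, [/\ 0 < D, forall w, normc (w - w0) < D / 2 -> Q w &
    exists2 ws, ~ Q ws & normc (ws - w0) <= D].
Proof.
move=> Qw0 e0 eQ QB.
pose P k := `[< exists2 w, ~ Q w & normc (w - w0) < e * 2 ^+ k >].
have exP : exists k, P k.
  pose far : C := w0 + (2 * `|B| + 1)%:C.
  have nfar : normc (far - w0) = 2 * `|B| + 1.
    by rewrite /far addrAC subrr add0r/= expr0n addr0 sqrtr_sqr ger0_norm// addr_ge0// mulr_ge0.
  have nQfar : ~ Q far.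
    move=> /QB h; have := normcB_le _ 0 far w0; rewrite nfar subr0 sub0r normc_opp.
    by have := QB _ Qw0; have := ler_norm B; lra.
  have [k _ kP] := near_infty_natSinv_expn_lt
    (PosNum (divr_gt0 e0 (ltr_pwDr ltr01 (mulr_ge0 (ler0n R 2) (normr_ge0 B))))).
  exists k; apply/asboolP; exists far => //; rewrite nfar.
  have := kP k (leqnn k); rewrite /= ltr_pdivlMr; last by rewrite ltr_wpDl// mulr_ge0.
  by rewrite mulrAC ltr_pdivrMr ?exprn_gt0// mul1r.
have [[|k] /asboolP[ws nQws wsD] kmin] := ex_minnP exP.
  by exfalso; apply/nQws/eQ; rewrite expr0 mulr1 in wsD.
have k2 : 0 < e * 2 ^+ k by rewrite mulr_gt0// exprn_gt0.
exists (e * 2 ^+ k.+1); split.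
- by rewrite mulr_gt0// exprn_gt0.
- have -> : e * 2 ^+ k.+1 / 2 = e * 2 ^+ k by rewrite exprSr mulrA mulfK// pnatr_eq0.
  move=> w wk; apply: contrapT => nQw.
  have : P k by apply/asboolP; exists w.
  by move=> /kmin; rewrite ltnn.
- by exists ws => //; exact: ltW.
Qed.

End Modulus.

(** * Choice of the constants and conclusion *)

Theorem theorem1 (R : realType) (K : R) (hK : 1 <= K) :
  exists delta : R,
    0 < delta < 1 /\
    forall (Q : quadrilateral R) (M : R),
      is_modulus Q M -> K^-1 <= M <= K ->
      exists (c : plane R) (r : R),
        r%:E = (delta%:E * maxe (s_a Q) (s_b Q))%E /\
        ball c r%:C `<=` dom Q.
Proof.
(* Strips have width M/4 or 1/4, so four times 2^10 + 65 M must be beaten; 261 = 4 * 65 + 1 makes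
   the inequality strict. The factor [K] absorbs [M] through 1 <= K M and M <= K. *)
pose B := (2 ^+ 12 + 261) * K.
have K0 : 0 < K by apply: lt_le_trans hK.
have B0 : 0 < B by rewrite /B; lra.
have [m mB] : exists m : nat, 6 * B < m%:R.
  by exists (Num.truncn (6 * B)).+1; exact: truncnS_gt.
have m0 : 0 < m%:R :> R by apply: lt_trans mB; rewrite pmulr_rgt0.
pose X := 6 * (2 ^+ (m * m) * (m%:R * B)).
have X0 : 0 < X by rewrite /X pmulr_rgt0// pmulr_rgt0 ?exprn_gt0// pmulr_rgt0.
(* Both distances are at most X D while the disk of radius D/2 lies in the domain; the term 2 forces
   [delta] below 1. *)
pose delta := (2 * X + 2)^-1.
have d0 : 0 < delta by rewrite invr_gt0; lra.
have d1 : delta < 1 by rewrite invf_lt1; lra.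
exists delta; split; first by rewrite d0.
move=> Q M [M0 [phi [hol phi_dom [phi_cl phi_cont [g [g_cont gK]]] [p1 p2 p3 p4]]]].
move=> /andP[KM MK].
have KM1 : 1 <= K * M by rewrite -ler_pdivrMl// mulr1.
have chart := inverse_chart_chart _ _ _ _ _ M0 hol phi_dom phi_cl phi_cont g_cont gK.
set G := inverse_chart R M g in chart.
pose w0 := G ((M / 2) +i* (1 / 2)).
have Qw0 : dom Q w0.
  apply: (chart_inv _ _ _ _ _ chart _ _).1.
  by rewrite /open_rect/=; apply/andP; split; apply/andP; split; lra.
have [e e0 eQ] := chart_open _ _ _ _ _ chart _ Qw0.
have [b bQ] := chart_bounded _ _ _ _ _ chart.
have [D [D0 DQ [ws nQws wsD]]] := inscribed_disk_scale _ _ _ _ _ Qw0 e0 eQ bQ.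
have BM : 2 ^+ 10 + 65 * M < B * (M / 4).
  have : K * M * (261 / 4) <= B * (M / 4) - K * M * 2 ^+ 10.
    by rewrite /B; lra.
  have : M <= K * M by rewrite ler_peMl// ltW.
  by lra.
have B1 : 2 ^+ 10 + 65 * M < B * (1 / 4) by rewrite /B; lra.
(* Level 3 is the first with 2^k >= 8, as [stage] requires. *)
have stages k : (3 <= k)%N -> _ :=
  fun k3 => stage _ _ _ _ _ chart _ _ _ _ B0 BM B1 D0 nQws wsD mB (2 ^ k)
    (leq_pexp2l (isT : (0 < 2)%N) k3).
pose Z := 6 * (2 ^+ (m * m) * D * (m%:R * B)).
have line_c (t : R) : continuous (fun x => G (x +i* t)).
  apply: (continuous_fun_comp R (plane R) (plane R) (fun x => x +i* t) G _
    (chart_cont _ _ _ _ _ chart)).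
  by apply: continuous_Complex => x; [exact: cvg_id|exact: cvg_cst].
have line_c' (t : R) : continuous (fun y => G ((M * t) +i* y)).
  apply: (continuous_fun_comp R (plane R) (plane R) (fun y => (M * t) +i* y) G _
    (chart_cont _ _ _ _ _ chart)).
  by apply: continuous_Complex => x; [exact: cvg_cst|exact: cvg_id].
have [x /andP[x1 x2] xlen] := limit_line _ (fun x t => G (x +i* t)) _ _ Z 3 line_c
  (fun k k3 => (stages k k3).1).
have [y /andP[y1 y2] ylen] := limit_line _ (fun y t => G ((M * t) +i* y)) _ _ Z 3 line_c'
  (fun k k3 => (stages k k3).2).
have sa : (s_a Q <= Z%:E)%E.
  apply: (s_a_le _ _ _ _ _ M0 phi_dom phi_cl phi_cont g_cont gK p1 p2 p3 p4 x) => //.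
  by apply/andP; split; lra.
have sb : (s_b Q <= Z%:E)%E.
  apply: (s_b_le _ _ _ _ _ M0 phi_dom phi_cl phi_cont g_cont gK p1 p2 p3 p4 y) => //.
  by apply/andP; split; lra.
have sm : (maxe (s_a Q) (s_b Q) <= Z%:E)%E by rewrite ge_max sa sb.
have sm0 : (0 <= maxe (s_a Q) (s_b Q))%E by rewrite le_max distance_within_ge0.
have sfin : maxe (s_a Q) (s_b Q) \is a fin_num.
  by rewrite ge0_fin_numE// (le_lt_trans sm)// ltry.
exists w0, (delta * fine (maxe (s_a Q) (s_b Q))); split.
  by rewrite EFinM fineK.
move=> w; rewrite ball_plane => wr; apply: DQ; apply: lt_le_trans wr _.
have sZ : fine (maxe (s_a Q) (s_b Q)) <= Z by rewrite -lee_fin fineK.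
apply: (@le_trans _ _ (delta * Z)); first by rewrite ler_pM2l.
rewrite /delta mulrC ler_pdivrMr; last by lra.
have -> : Z = X * D by rewrite /Z /X; ring.
by lra.
Qed.
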